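(* For all integers $d,k\ge 1$ and every real $\delta>0$ there exists a constant $\beta=\beta(d,\delta,k)>0$ such that the following holds. Let $P$ be a sequence of $n$ points in general position in $\mathbb{R}^d$, let $I\subseteq[k]^{(d+1)}_{<}$, and let $\mathcal{T}$ be a family of at least $\delta\binom{n}{k}$ subsequences of $k$ points of $P$, all of them copies of some sequence $\rho$ of $k$ points in $\mathbb{R}^d$. Then there exist a subfamily $\mathcal{T}'\subset\mathcal{T}$ with at least $\beta\binom{n}{k}$ elements, and an indexed point set $Q=\{q_t\in\mathbb{R}^d : t\in I\}$, such that $Q$ pins every element of $\mathcal{T}'$.
   Context: A set (or sequence) of points in $\mathbb{R}^d$ is in general position if no $j\le d+1$ of them lie in a common $(j-2)$-flat (in particular the points are distinct). $[k]^{(d+1)}_{<}$ denotes the set of all tuples $t=(t(1),\dots,t(d+1))$ of integers with $1\le t(1)<\cdots<t(d+1)\le k$. For a sequence $\tau$ of $k$ points and $t\in[k]^{(d+1)}_{<}$, $\tau[t]:=(\tau(t(1)),\dots,\tau(t(d+1)))$. An indexed point set $Q=\{q_t: t\in I\}$ pins a sequence $\tau$ of $k$ points in $\mathbb{R}^d$ if, for every $t\in I$, the point $q_t$ is contained in the interior of the simplex with vertices $\tau[t]$. Orientation: $\chi(p_1,\dots,p_{d+1})=\operatorname{sgn}\det M$, where $M$ is the $(d+1)\times(d+1)$ matrix whose $i$-th row is $(1,p_i(1),\dots,p_i(d))$. Two sequences $\sigma,\tau$ of $k$ points are copies of one another if $\chi(\sigma(i_1),\dots,\sigma(i_{d+1}))=\chi(\tau(i_1),\dots,\tau(i_{d+1}))$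 for all $1\le i_1<\cdots<i_{d+1}\le k$ (no coloring is involved here). *)

(* Defs.v *)
From mathcomp Require Import all_boot all_order all_algebra.
From mathcomp Require Import classical_sets reals topology normedtype.

Set Implicit Arguments.
Unset Strict Implicit.
Unset Printing Implicit Defensive.

Import Order.TTheory GRing.Theory Num.Theory.
Import numFieldNormedType.Exports.

Local Open Scope ring_scope.

(* [increasing m k] is [k]^{(m)}_<, with 'I_k = {0, ..., k-1} standing for
   [k] = {1, ..., k}.  If [p : 'I_k -> E] is a sequence of k points and
   [t \in increasing m k], then [p \o t] is the subsequence p[t]. *)
Definition increasing (m k : nat) : {set {ffun 'I_m -> 'I_k}} :=
  [set t : {ffun 'I_m -> 'I_k} |
    [forall i : 'I_m, forall j : 'I_m, (i < j)%N ==> (t i < t j)%N]]%SET.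

Definition is_flat (R : realType) (d m : nat) (F : set 'rV[R]_d) : Prop :=
  exists (a : 'rV[R]_d) (V : {vspace 'rV[R]_d}),
    \dim V = m /\ F = [set x | x - a \in V]%classic.

(* The number of points j = m + 2 starts at 2, since the (-1)-flat (j = 1)
   is empty.  The points are counted by their indices, so that the case j = 2
   says that the sequence has no repetition. *)
Definition general_position (R : realType) (d n : nat)
    (P : 'I_n -> 'rV[R]_d) : Prop :=
  forall (m : nat) (J : {set 'I_n}), #|J| = m.+2 -> (m.+2 <= d.+1)%N ->
  forall F : set 'rV[R]_d, is_flat m F -> ~ (forall i, i \in J -> F (P i)).

Definition orientation_mx (R : realType) (d : nat)
    (p : 'I_d.+1 -> 'rV[R]_d) : 'M[R]_d.+1 :=
  \matrix_(i < d.+1) row_mx (1%:M : 'M[R]_1) (p i).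

Definition chi (R : realType) (d : nat) (p : 'I_d.+1 -> 'rV[R]_d) : R :=
  Num.sg (\det (orientation_mx p)).

Definition copies (R : realType) (d k : nat)
    (sigma tau : 'I_k -> 'rV[R]_d) : Prop :=
  forall t, t \in increasing d.+1 k -> chi (sigma \o t) = chi (tau \o t).

Definition simplex (R : realType) (d : nat)
    (p : 'I_d.+1 -> 'rV[R]_d) : set 'rV[R]_d :=
  [set x | exists w : 'I_d.+1 -> R,
    [/\ forall i, 0 <= w i, \sum_i w i = 1 & x = \sum_i w i *: p i]]%classic.

(* An indexed set {q_t : t \in I} is given by a total function [q], whose
   values outside [I] play no role. *)
Definition pins (R : realType) (d k : nat) (I : {set {ffun 'I_d.+1 -> 'I_k}})
    (q : {ffun 'I_d.+1 -> 'I_k} -> 'rV[R]_d) (tau : 'I_k -> 'rV[R]_d) : Prop :=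
  forall t, t \in I -> interior (simplex (tau \o t)) (q t).

(* Main.v *)
(* Lift a point p to the vector (1, p), so that the interiors of simplices become open
   simplicial cones.  The tuples t are handled one after the other, each time replacing T
   by a positive fraction of itself, so a single t suffices: given a dense weight on the
   (d+1)-tuples of points, some point lies in the cones of a positive fraction of them.

   Partition the points at random into d+1 classes B_i.  A near-minimizer g of
   sum_i avg_{B_i} ln |v g| - ln |det g| puts the vectors, after normalization, in
   nearly isotropic position, so that no k+1 classes concentrate near a k-dimensional
   subspace.  By a quantitative form of Rado's theorem on independent transversals,
   a random transversal then has a determinant bounded away from 0 with positive
   probability.  Cutting the unit sphere into small cells, a positive fraction of
   the transversals falls into products of cells for which all the cones share a point.
   Either the weight charges such a product, or it has larger density on some product of
   cells that is a fixed fraction of the box; iterate in the latter case. *)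
Require Import Defs.
From mathcomp Require Import all_boot all_order all_algebra all_fingroup.
From mathcomp Require Import boolp classical_sets reals topology normedtype exp.
From mathcomp Require Import ring lra zify.

Set Implicit Arguments.
Unset Strict Implicit.
Unset Printing Implicit Defensive.

Import Order.TTheory GRing.Theory Num.Theory.
Import numFieldNormedType.Exports.

Local Open Scope ring_scope.

(** * Finite sums and determinants *)

Lemma sum_ffun_split (V : nmodType) (k l : nat) (T : finType)
    (F : {ffun 'I_(k + l) -> T} -> V) :
  \sum_s F s = \sum_(s1 : {ffun 'I_k -> T}) \sum_(s2 : {ffun 'I_l -> T})
    F [ffun i => match split i with inl j => s1 j | inr j => s2 j end].
Proof.
pose h (p : {ffun 'I_k -> T} * {ffun 'I_l -> T}) : {ffun 'I_(k + l) -> T} :=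
  [ffun i => match split i with inl j => p.1 j | inr j => p.2 j end].
pose g (s : {ffun 'I_(k + l) -> T}) : {ffun 'I_k -> T} * {ffun 'I_l -> T} :=
  ([ffun j => s (lshift l j)], [ffun j => s (rshift k j)]).
rewrite pair_big (reindex h) //; exists g => [[s1 s2]|s] _.
  congr (_, _); apply/ffunP => j; rewrite !ffunE.
    by case: split_ordP => j' /eqP; rewrite ?eq_lshift ?eq_lrshift // => /eqP ->.
  by case: split_ordP => j' /eqP; rewrite ?eq_rshift ?eq_rlshift // => /eqP ->.
by apply/ffunP => i; rewrite ffunE; case: split_ordP => j ->; rewrite ffunE.
Qed.

Lemma sqr_sum_le (R : realFieldType) (I : finType) (P : pred I) (F : I -> R) :
  (\sum_(i | P i) F i) ^+ 2 <= #|P|%:R * \sum_(i | P i) F i ^+ 2.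
Proof.
rewrite expr2 big_distrlr /=.
pose G i j := 2^-1 * F i ^+ 2 + 2^-1 * F j ^+ 2.
have h i j : F i * F j <= G i j.
  by have := sqr_ge0 (F i - F j); rewrite /G sqrrB; lra.
apply: (@le_trans _ _ (\sum_(i | P i) \sum_(j | P j) G i j)).
  by apply: ler_sum => i _; apply: ler_sum => j _.
rewrite /G; under [leLHS]eq_bigr => i _ do rewrite big_split sumr_const -mulr_sumr -mulr_natl.
rewrite big_split sumr_const /= sumrMnl -mulr_sumr -[X in X + _]mulr_natl.
set S := \sum_(i | P i) _.
rewrite -[X in _ + X]mulr_natl -mulrDr.
suff -> : (2 * 1)^-1 * S + (2 * 1)^-1 * S = S by [].
by rewrite mulr1; lra.
Qed.

(** Telescoping: the factors are exchanged one at a time, and the factors that remain have modulus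
    at most 1. *)
Lemma prod_sub_le (R : realDomainType) (I : finType) (F G : I -> R) :
  (forall i, `|F i| <= 1) -> (forall i, `|G i| <= 1) ->
  `|\prod_i F i - \prod_i G i| <= \sum_i `|F i - G i|.
Proof.
move=> hF hG.
suff: forall r : seq I, [&& `|\prod_(i <- r) F i| <= 1, `|\prod_(i <- r) G i| <= 1 &
   `|\prod_(i <- r) F i - \prod_(i <- r) G i| <= \sum_(i <- r) `|F i - G i|].
  by move=> /(_ (index_enum I)) /and3P[].
elim=> [|i r /and3P[h1 h2 h3]]; first by rewrite !big_nil subrr normr0 normr1 !lexx.
rewrite !big_cons; apply/and3P; split.
- by rewrite normrM mulr_ile1.
- by rewrite normrM mulr_ile1.
set f := \prod_(j <- r) F j; set g := \prod_(j <- r) G j.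
have -> : F i * f - G i * g = (F i - G i) * f + G i * (f - g) by ring.
apply: le_trans (ler_normD _ _) _; rewrite !normrM lerD //.
  by rewrite ler_piMr.
by apply: le_trans h3; rewrite ler_piMl.
Qed.

Lemma det_sub_le (R : realDomainType) (D : nat) (M N : 'M[R]_D) :
  (forall i j, `|M i j| <= 1) -> (forall i j, `|N i j| <= 1) ->
  `|\det M - \det N| <= D`!%:R * \sum_i \sum_j `|M i j - N i j|.
Proof.
move=> hM hN; rewrite -sumrB; apply: le_trans (ler_norm_sum _ _ _) _.
have <- : #|{: 'S_D}| = D`! by rewrite card_Sn.
rewrite mulr_natl -sumr_const; apply: ler_sum => /= s _.
rewrite -mulrBr normrM normrX normrN1 expr1n mul1r.
apply: le_trans (prod_sub_le _ _) _ => //; apply: ler_sum => i _.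
by rewrite (bigD1 (s i)) //= lerDl sumr_ge0.
Qed.

Lemma det_le_fact (R : realDomainType) (D : nat) (M : 'M[R]_D) :
  (forall i j, `|M i j| <= 1) -> `|\det M| <= D`!%:R.
Proof.
move=> hM; apply: le_trans (ler_norm_sum _ _ _) _.
have <- : #|{: 'S_D}| = D`! by rewrite card_Sn.
rewrite -sumr_const; apply: ler_sum => /= s _.
rewrite normrM normrX normrN1 expr1n mul1r normr_prod.
by apply: prodr_ile1 => i _; rewrite normr_ge0 hM.
Qed.

(** * Euclidean vectors *)

(** For orthogonal [O], [tail k (u *m O)] is the squared distance from [u] to the span of the first
    [k] columns of [O]. *)
Definition tail (R : nzRingType) (D k : nat) (u : 'rV[R]_D) : R :=
  \sum_(j < D | (k <= j)%N) u 0 j ^+ 2.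

Definition sqnorm (R : nzRingType) (D : nat) (u : 'rV[R]_D) : R := \sum_j u 0 j ^+ 2.

Lemma sqnormE (R : nzRingType) (D : nat) (u : 'rV[R]_D) :
  (u *m u^T) = (sqnorm u)%:M.
Proof.
apply/matrixP => i j; rewrite !ord1 !mxE eqxx mulr1n.
by apply: eq_bigr => k _; rewrite !mxE expr2.
Qed.

Lemma sqnorm_orthogonal (R : comNzRingType) (D : nat) (u : 'rV[R]_D) (O : 'M[R]_D) :
  O *m O^T = 1%:M -> sqnorm (u *m O) = sqnorm u.
Proof.
move=> hO; have := sqnormE (u *m O).
rewrite trmx_mul mulmxA -(mulmxA u) hO mulmx1 sqnormE => /matrixP /(_ 0 0).
by rewrite !mxE eqxx !mulr1n.
Qed.

Lemma tail_ge0 (R : realDomainType) (D k : nat) (u : 'rV[R]_D) : 0 <= tail k u.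
Proof. by apply: sumr_ge0 => j _; exact: sqr_ge0. Qed.

Lemma tail0 (R : comNzRingType) (D : nat) (u : 'rV[R]_D) : tail 0 u = sqnorm u.
Proof. by []. Qed.

Lemma sqnorm_row_mx (R : comNzRingType) (k l : nat) (u : 'rV[R]_(k + l)) :
  sqnorm u = sqnorm (lsubmx u) + sqnorm (rsubmx u).
Proof.
by rewrite /sqnorm big_split_ord; congr (_ + _); apply: eq_bigr => j _; rewrite mxE.
Qed.

Lemma tail_row_mx_l (R : comNzRingType) (k l m : nat) (u : 'rV[R]_(k + l)) :
  (m <= k)%N -> tail m u = tail m (lsubmx u) + sqnorm (rsubmx u).
Proof.
move=> mk; rewrite /tail big_split_ord; congr (_ + _).
  by apply: eq_bigr => j _; rewrite mxE.
apply: eq_big => j; first by rewrite /= (leq_trans mk) ?leq_addr.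
by rewrite mxE.
Qed.

Lemma tail_row_mx_r (R : comNzRingType) (k l m : nat) (u : 'rV[R]_(k + l)) :
  tail (k + m) u = tail m (rsubmx u).
Proof.
rewrite /tail big_split_ord /= big_pred0 ?add0r => [|j].
  by apply: eq_big => j; rewrite ?leq_add2l // mxE.
by apply/negbTE; rewrite -ltnNge (leq_trans (ltn_ord j)) ?leq_addr.
Qed.

Lemma entry_le1 (R : realDomainType) (D : nat) (u : 'rV[R]_D) j :
  sqnorm u <= 1 -> `|u 0 j| <= 1.
Proof.
move=> h; rewrite -(@expr_le1 _ 2) // real_normK ?num_real //.
by apply: le_trans h; rewrite /sqnorm (bigD1 j) //= lerDl sumr_ge0 // => i _; exact: sqr_ge0.
Qed.

Lemma orthogonal_block (R : comNzRingType) (k l : nat) (O1 : 'M[R]_k) (O2 : 'M[R]_l) :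
  O1 *m O1^T = 1%:M -> O2 *m O2^T = 1%:M ->
  block_mx O1 0 0 O2 *m (block_mx O1 0 0 O2)^T = 1%:M.
Proof.
move=> h1 h2; rewrite tr_block_mx mulmx_block !trmx0 !mulmx0 !mul0mx !addr0 add0r.
by rewrite h1 h2 -scalar_mx_block.
Qed.

Lemma det_orthogonal_sqr (R : comNzRingType) (D : nat) (O : 'M[R]_D) :
  O *m O^T = 1%:M -> (\det O) ^+ 2 = 1.
Proof. by move=> h; rewrite expr2 -{2}det_tr -det_mulmx h det1. Qed.

(* Householder reflection *)
Lemma orthogonal_to_first (R : rcfType) (m : nat) (u : 'rV[R]_(1 + m)) :
  exists (O : 'M[R]_(1 + m)) (r : R),
    [/\ O *m O^T = 1%:M, u *m O = row_mx r%:M 0 & r ^+ 2 = sqnorm u].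
Proof.
pose r := Num.sqrt (sqnorm u).
have hr : r ^+ 2 = sqnorm u.
  by rewrite sqr_sqrtr //; apply: sumr_ge0 => j _; exact: sqr_ge0.
pose e : 'rV[R]_(1 + m) := row_mx r%:M 0; pose w := u - e.
have [w0|w0] := eqVneq (sqnorm w) 0.
  exists 1%:M, r; split => //; first by rewrite trmx1 mulmx1.
  rewrite mulmx1; apply/subr0_eq/matrixP => i j; rewrite !ord1 [in RHS]mxE.
  have : w 0 j ^+ 2 = 0 by apply: (psumr_eq0P _ w0) => // ? _; exact: sqr_ge0.
  by move/eqP; rewrite sqrf_eq0 => /eqP.
pose s := sqnorm w; pose O := 1%:M - (2 / s) *: (w^T *m w).
exists O, r; split => //.
  have tO : O^T = O by rewrite /O linearB linearZ /= trmx1 trmx_mul trmxK.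
  have h : (w^T *m w) *m (w^T *m w) = s *: (w^T *m w).
    by rewrite mulmxA -(mulmxA w^T) sqnormE -/s -mulmxA mul_scalar_mx -scalemxAr.
  rewrite tO /O; set A := w^T *m w in h *; clearbody A.
  rewrite mulmxBl mul1mx mulmxBr mulmx1 -scalemxAl -scalemxAr h !scalerA.
  rewrite -mulrA divfK //; apply/matrixP => i j; rewrite !mxE; ring.
(* Since [u] and [e] have equal norms, [w = u - e] has squared norm twice its inner product with
   [u]. *)
have uw : u *m w^T = (s / 2)%:M.
  have ue : u *m e^T = e *m u^T by apply/matrixP => i j; rewrite !ord1 !mxE;
    apply: eq_bigr => k _; rewrite !mxE mulrC.
  have ee : e *m e^T = u *m u^T.
    by rewrite tr_row_mx mul_row_col trmx0 mulmx0 addr0 tr_scalar_mx -scalar_mxM -expr2 hr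
      sqnormE.
  have : w *m w^T = 2%:R *: (u *m w^T).
    rewrite /w linearB /= mulmxBl !mulmxBr ee ue scaler_nat opprB mulrnBl.
    by rewrite -mulr2n mulrnBl.
  rewrite sqnormE -/s => H.
  apply: (@scalerI _ _ (2%:R : R)); first by rewrite pnatr_eq0.
  by rewrite -H scale_scalar_mx mulrC divfK // pnatr_eq0.
rewrite mulmxBr mulmx1 -scalemxAr mulmxA uw mul_scalar_mx scalerA.
have -> : 2 / s * (s / 2) = 1 by field.
by rewrite scale1r /w opprB addrC subrK.
Qed.

(** * Random transversals *)

(* The expectation of the squared determinant when row [i] is drawn from [u i] with
   weights [mu i], independently. *)
Definition edet2 (R : comNzRingType) (D : nat) (T : finType) (mu : 'I_D -> T -> R)
    (u : 'I_D -> T -> 'rV[R]_D) : R :=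
  \sum_(s : {ffun 'I_D -> T}) (\prod_i mu i (s i)) * (\det (\matrix_i u i (s i))) ^+ 2.

(* A quantitative Hall-Rado condition: a [k]-dimensional subspace, the span of the first
   [k] vectors of an orthonormal basis given by [O], misses a mass at least [e] of any
   [k.+1] of the classes. *)
Definition spread (R : numDomainType) (D : nat) (T : finType) (mu : 'I_D -> T -> R)
    (u : 'I_D -> T -> 'rV[R]_D) (e : R) : Prop :=
  forall (S : {set 'I_D}) (O : 'M[R]_D) (k : nat), O *m O^T = 1%:M -> #|S| = k.+1 ->
  e <= \sum_(i in S) \sum_a mu i a * tail k (u i a *m O).

Lemma marginal (R : comNzRingType) (I T : finType) (mu : I -> T -> R) (f : T -> R) i0 :
  (forall i, \sum_a mu i a = 1) ->
  \sum_(s : {ffun I -> T}) (\prod_i mu i (s i)) * f (s i0) = \sum_a mu i0 a * f a.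
Proof.
move=> mu1; pose F i a := mu i a * (if i == i0 then f a else 1).
transitivity (\sum_(s : {ffun I -> T}) \prod_i F i (s i)).
  apply: eq_bigr => s _; rewrite big_split /=; congr (_ * _).
  by rewrite (bigD1 i0) //= eqxx big1 ?mulr1 // => i /negbTE ->.
rewrite -bigA_distr_bigA (bigD1 i0) //= [X in _ * X]big1 ?mulr1 => [|i /negbTE ne].
  by apply: eq_bigr => a _; rewrite /F eqxx.
by rewrite -[RHS](mu1 i); apply: eq_bigr => a _; rewrite /F ne mulr1.
Qed.

(** Squaring removes the sign of [\det O]. Together with the three lemmas that follow, this lets any
    [k] classes and any [k]-dimensional subspace be moved to the first [k] indices and the first [k]
    coordinates. *)
Lemma edet2_rotate (R : comNzRingType) (D : nat) (T : finType) (mu : 'I_D -> T -> R)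
    (u : 'I_D -> T -> 'rV[R]_D) (O : 'M[R]_D) : O *m O^T = 1%:M ->
  edet2 mu (fun i a => u i a *m O) = edet2 mu u.
Proof.
move=> hO; apply: eq_bigr => s _; congr (_ * _).
have -> : \matrix_i (u i (s i) *m O) = (\matrix_i u i (s i)) *m O.
  by apply/row_matrixP => i; rewrite row_mul !rowK.
by rewrite det_mulmx exprMn (det_orthogonal_sqr hO) mulr1.
Qed.

Lemma edet2_perm (R : comNzRingType) (D : nat) (T : finType) (mu : 'I_D -> T -> R)
    (u : 'I_D -> T -> 'rV[R]_D) (p : 'S_D) :
  edet2 (fun i => mu (p i)) (fun i => u (p i)) = edet2 mu u.
Proof.
pose h (s : {ffun 'I_D -> T}) : {ffun 'I_D -> T} := [ffun i => s (p i)].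
rewrite /edet2 (reindex h) /=; last first.
  exists (fun s : {ffun 'I_D -> T} => [ffun i => s (p^-1 i)%g]) => s _;
    by apply/ffunP => i; rewrite !ffunE ?permKV ?permK.
apply: eq_bigr => s _; congr (_ * _).
  by rewrite [RHS](reindex_inj (@perm_inj _ p)) /=; apply: eq_bigr => i _; rewrite ffunE.
have -> : \matrix_i u (p i) (h s i) = row_perm p (\matrix_i u i (s i)).
  by apply/row_matrixP => i; rewrite rowK row_permEsub row_rowsub rowK ffunE.
by rewrite row_permE det_mulmx det_perm exprMn sqrr_sign mul1r.
Qed.

Lemma spread_perm (R : numDomainType) (D : nat) (T : finType) (mu : 'I_D -> T -> R)
    (u : 'I_D -> T -> 'rV[R]_D) (p : 'S_D) e :
  spread mu u e -> spread (fun i => mu (p i)) (fun i => u (p i)) e.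
Proof.
move=> h S O k hO hS.
have := h (p @: S) O k hO; rewrite card_imset; last exact: perm_inj.
move=> /(_ hS); rewrite big_imset //= => i j _ _; exact: perm_inj.
Qed.

Lemma spread_rotate (R : numDomainType) (D : nat) (T : finType) (mu : 'I_D -> T -> R)
    (u : 'I_D -> T -> 'rV[R]_D) (O : 'M[R]_D) e : O *m O^T = 1%:M ->
  spread mu u e -> spread mu (fun i a => u i a *m O) e.
Proof.
move=> hO h S O' k hO' hS; under eq_bigr do under eq_bigr do rewrite -mulmxA.
by apply: h => //; rewrite trmx_mul mulmxA -(mulmxA O) hO' mulmx1.
Qed.

(* The determinant is compared with that of the block triangular matrix obtained by
   erasing the upper right block. *)
Lemma det_block_error (R : realFieldType) (k l : nat) (M : 'M[R]_(k + l)) :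
  (forall i j, `|M i j| <= 1) ->
  2^-1 * ((\det (ulsubmx M)) ^+ 2 * (\det (drsubmx M)) ^+ 2) -
    (k + l)`!%:R ^+ 2 * (k * l)%:R * (\sum_i \sum_j ursubmx M i j ^+ 2)
  <= (\det M) ^+ 2.
Proof.
move=> hM; pose N := block_mx (ulsubmx M) 0 (dlsubmx M) (drsubmx M).
have hN i j : `|N i j| <= 1.
  rewrite /N; case: (split_ordP i) => i' ->; case: (split_ordP j) => j' ->;
    by rewrite ?block_mxEul ?block_mxEur ?block_mxEdl ?block_mxEdr ?mxE ?normr0.
have dN : \det N = \det (ulsubmx M) * \det (drsubmx M) by rewrite det_lblock.
have hMN := det_sub_le hM hN.
have hs : \sum_i \sum_j `|M i j - N i j| = \sum_i \sum_j `|ursubmx M i j|.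
  rewrite big_split_ord /= [X in _ + X]big1 => [|i _].
    rewrite addr0; apply: eq_bigr => i _; rewrite big_split_ord /= big1 ?add0r => [|j _].
      by apply: eq_bigr => j _; rewrite /N block_mxEur !mxE subr0.
    by rewrite /N block_mxEul !mxE subrr normr0.
  apply: big1 => j _; case: (split_ordP j) => j' ->;
    by rewrite /N ?block_mxEdl ?block_mxEdr !mxE subrr normr0.
(* Cauchy-Schwarz turns the sum of moduli into a sum of squares, which on average becomes a sum of
   [tail k] terms. *)
have hcs : (\sum_i \sum_j `|ursubmx M i j|) ^+ 2 <= (k * l)%:R * \sum_i \sum_j ursubmx M i
  j ^+ 2.
  rewrite !pair_big /=; apply: le_trans (sqr_sum_le _ _) _.
  rewrite cardE /= -cardE card_prod !card_ord.
  by under eq_bigr do rewrite real_normK ?num_real //; rewrite lexx.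
have herr : (\det M - \det N) ^+ 2 <=
    (k + l)`!%:R ^+ 2 * (k * l)%:R * (\sum_i \sum_j ursubmx M i j ^+ 2).
  rewrite -[(_ - _) ^+ 2]real_normK ?num_real //.
  apply: (@le_trans _ _ (((k + l)`!%:R * \sum_i \sum_j `|M i j - N i j|) ^+ 2)).
    by rewrite lerXn2r // nnegrE // (le_trans _ hMN).
  by rewrite exprMn hs -mulrA ler_wpM2l // sqr_ge0.
(* With [x = \det M] and [y = \det N], expanding [(2x - y)^2 >= 0] gives
   [y^2 / 2 - (x - y)^2 <= x^2]. *)
have := sqr_ge0 (\det M + (\det M - \det N)); rewrite -exprMn -dN.
move: herr; set e := _ * _; set x := \det M; set y := \det N.
by move=> *; nra.
Qed.

(** * Splitting the classes into two diagonal blocks *)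

Section Block.
Variables (R : realFieldType) (k l : nat) (T : finType).
Variables (mu : 'I_(k + l) -> T -> R) (u : 'I_(k + l) -> T -> 'rV[R]_(k + l)).
Hypothesis mu0 : forall i a, 0 <= mu i a.
Hypothesis mu1 : forall i, \sum_a mu i a = 1.
Hypothesis u1 : forall i a, sqnorm (u i a) <= 1.

Let mu_l i := mu (lshift l i).
Let mu_r i := mu (rshift k i).
Let u_l i a := lsubmx (u (lshift l i) a).
Let u_r i a := rsubmx (u (rshift k i) a).
Let defect := \sum_(i < k) \sum_a mu (lshift l i) a * tail k (u (lshift l i) a).

(** This is [det_block_error] averaged over the transversals. The two diagonal blocks depend on
    disjoint sets of rows, so by independence the mean of the product factors; the squared entries
    in a row of the upper right block add up to [tail k] of that row. *)
Lemma edet2_block :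
  2^-1 * (edet2 (fun i => mu (lshift l i)) (fun i a => lsubmx (u (lshift l i) a)) *
          edet2 (fun i => mu (rshift k i)) (fun i a => rsubmx (u (rshift k i) a))) -
    (k + l)`!%:R ^+ 2 * (k * l)%:R *
      (\sum_(i < k) \sum_a mu (lshift l i) a * tail k (u (lshift l i) a))
  <= edet2 mu u.
Proof.
rewrite -/mu_l -/u_l -/mu_r -/u_r -/defect.
pose L : R := (k + l)`!%:R ^+ 2 * (k * l)%:R; rewrite -/L.
pose A (s : {ffun 'I_(k + l) -> T}) := \det (ulsubmx (\matrix_i u i (s i))) ^+ 2.
pose B (s : {ffun 'I_(k + l) -> T}) := \det (drsubmx (\matrix_i u i (s i))) ^+ 2.
pose W (s : {ffun 'I_(k + l) -> T}) := \prod_i mu i (s i).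
have hprod : edet2 mu_l u_l * edet2 mu_r u_r = \sum_s W s * (A s * B s).
  rewrite sum_ffun_split /edet2 big_distrlr /=.
  apply: eq_bigr => s1 _; apply: eq_bigr => s2 _.
  set s := [ffun i => _].
  have sl i : s (lshift l i) = s1 i by rewrite /s ffunE (unsplitK (inl i)).
  have sr i : s (rshift k i) = s2 i by rewrite /s ffunE (unsplitK (inr i)).
  have -> : W s = (\prod_i mu_l i (s1 i)) * \prod_i mu_r i (s2 i).
    by rewrite /W big_split_ord; congr (_ * _); apply: eq_bigr => i _; rewrite ?sl ?sr.
  have -> : A s = \det (\matrix_i u_l i (s1 i)) ^+ 2.
    by congr (\det _ ^+ 2); apply/matrixP => i j; rewrite !mxE sl.
  have -> : B s = \det (\matrix_i u_r i (s2 i)) ^+ 2.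
    by congr (\det _ ^+ 2); apply/matrixP => i j; rewrite !mxE sr.
  ring.
have hdef : defect = \sum_s W s * \sum_(i < k) tail k (u (lshift l i) (s (lshift l i))).
  under [RHS]eq_bigr do rewrite mulr_sumr.
  rewrite exchange_big /=; apply: eq_bigr => i _.
  by rewrite (@marginal _ _ _ mu (fun a => tail k (u (lshift l i) a))).
rewrite hprod hdef !mulr_sumr -sumrB; apply: ler_sum => s _.
have W0 : 0 <= W s by apply: prodr_ge0.
rewrite mulrCA (mulrCA L) -mulrBr; apply: ler_wpM2l => //.
have hM i j : `|(\matrix_i u i (s i)) i j| <= 1 by rewrite mxE; exact: entry_le1.
apply: le_trans (det_block_error hM); rewrite -/L lerB // ler_wpM2l //.
  by rewrite mulr_ge0 // sqr_ge0.
apply: ler_sum => i _; rewrite -[X in tail X _]addn0 tail_row_mx_r.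
by apply: ler_sum => j _; rewrite !mxE.
Qed.

(** A subspace of the first [k] coordinates is also a subspace of the whole space. The squared
    distances to it grow by [tail k] when measured there, and these terms add up to at most the
    defect. *)
Lemma spread_l e : spread mu u e ->
  spread (fun i => mu (lshift l i)) (fun i a => lsubmx (u (lshift l i) a))
    (e - \sum_(i < k) \sum_a mu (lshift l i) a * tail k (u (lshift l i) a)).
Proof.
rewrite -/mu_l -/u_l -/defect.
move=> h S O m hO hS; rewrite lerBlDr.
have hm : (m.+1 <= k)%N by rewrite -hS -[k in (_ <= k)%N]card_ord max_card.
apply: le_trans (h (lshift l @: S) (block_mx O 0 0 1%:M) m _ _) _.
- by apply: orthogonal_block; rewrite // trmx1 mulmx1.
- by rewrite card_imset //; exact: lshift_inj.
rewrite big_imset /=; last by move=> i j _ _; exact: lshift_inj.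
rewrite /defect [X in _ <= _ + X](bigID (fun i => i \in S)) /= addrA.
apply: ler_wpDr; first by do 2![apply: sumr_ge0 => ? _]; rewrite mulr_ge0 ?tail_ge0.
rewrite -big_split; apply: ler_sum => i _; rewrite -big_split; apply: ler_sum => a _ /=.
rewrite -mulrDr ler_wpM2l // tail_row_mx_l 1?ltnW //.
set v := u _ a; rewrite -[v]hsubmxK mul_row_block !mulmx0 addr0 add0r mulmx1.
rewrite row_mxKl row_mxKr /u_l -/v lerD2l.
by rewrite -[X in tail X _]addn0 tail_row_mx_r row_mxKr tail0.
Qed.

(** The condition is applied to all [k] left classes together with [S], and to the sum of the first
    [k] coordinates and the given [m]-dimensional subspace: [k + m + 1] classes against dimension
    [k + m]. The left classes contribute at most the defect. *)
Lemma spread_r e : spread mu u e ->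
  spread (fun i => mu (rshift k i)) (fun i a => rsubmx (u (rshift k i) a))
    (e - \sum_(i < k) \sum_a mu (lshift l i) a * tail k (u (lshift l i) a)).
Proof.
rewrite -/mu_r -/u_r -/defect.
move=> h S O m hO hS; rewrite lerBlDr.
pose Sl : {set 'I_(k + l)} := @lshift k l @: 'I_k.
pose Sr : {set 'I_(k + l)} := @rshift k l @: S.
have dis : [disjoint Sl & Sr].
  apply/pred0P => x /=; apply/negbTE/negP => /andP[/imsetP[i _ ->] /imsetP[j _ /eqP]].
  by rewrite eq_lrshift.
apply: le_trans (h (Sl :|: Sr) (block_mx 1%:M 0 0 O) (k + m)%N _ _) _.
- by apply: orthogonal_block; rewrite // trmx1 mulmx1.
- rewrite cardsU disjoint_setI0 // cards0 subn0 (card_imset _ (@lshift_inj _ _)).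
  by rewrite (card_imset _ (@rshift_inj _ _)) card_ord hS addnS.
rewrite (eq_bigl [predU Sl & Sr]) => [|i]; last by rewrite !inE.
rewrite bigU //= addrC !big_imset /=; try by move=> i j _ _;
  (exact: lshift_inj || exact: rshift_inj).
have tl (v : 'rV_(k + l)) : tail (k + m) (v *m block_mx 1%:M 0 0 O) = tail m (rsubmx v *m O).
  by rewrite (tail_row_mx_r m (v *m block_mx 1%:M 0 0 O));
    rewrite -[v in LHS]hsubmxK mul_row_block !mulmx0 add0r row_mxKr.
apply: lerD.
  by apply: ler_sum => i _; apply: ler_sum => a _; rewrite tl.
rewrite (eq_bigl xpredT); last by move=> i; rewrite inE.
apply: ler_sum => i _; apply: ler_sum => a _; rewrite tl ler_wpM2l //.
rewrite -[X in _ <= tail X _]addn0 tail_row_mx_r tail0 -(sqnorm_orthogonal _ hO).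
by rewrite /tail [leRHS](bigID (fun j : 'I_l => (m <= j)%N)) /= lerDl sumr_ge0 // => j _;
  exact: sqr_ge0.
Qed.

End Block.

(** Condition on the vector drawn from class 0 and rotate it onto the first axis. The squared
    determinant is then its squared length times that of the other rows projected orthogonally to
    it, and [c] bounds the mean of the latter for every direction. *)
Lemma edet2_split_first (R : rcfType) (m : nat) (T : finType)
    (mu : 'I_(1 + m) -> T -> R) (u : 'I_(1 + m) -> T -> 'rV[R]_(1 + m)) (c : R) :
  (forall i a, 0 <= mu i a) ->
  (forall O : 'M[R]_(1 + m), O *m O^T = 1%:M ->
    c <= edet2 (fun i => mu (rshift 1 i)) (fun i b => rsubmx (u (rshift 1 i) b *m O))) ->
  (\sum_a mu 0 a * sqnorm (u 0 a)) * c <= edet2 mu u.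
Proof.
move=> mu0 hc; rewrite mulr_suml /edet2 sum_ffun_split.
rewrite (reindex (fun a : T => [ffun _ : 'I_1 => a])) /=; last first.
  exists (fun s : {ffun 'I_1 -> T} => s 0) => s _; first by rewrite ffunE.
  by apply/ffunP => i; rewrite ffunE ord1.
apply: ler_sum => a _.
have [O [r [hO hu hr]]] := orthogonal_to_first (u 0 a).
have e0 : 0 = lshift m 0 :> 'I_(1 + m) by apply/val_inj.
have -> : \sum_(s2 : {ffun 'I_m -> T})
   (\prod_i mu i ([ffun i0 => match split i0 with
                             | inl j => [ffun=> a] j | inr j => s2 j end] i)) *
   \det (\matrix_i u i ([ffun i0 => match split i0 with
                             | inl j => [ffun=> a] j | inr j => s2 j end] i)) ^+ 2 =
  mu 0 a * sqnorm (u 0 a) *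
    edet2 (fun i => mu (rshift 1 i)) (fun i b => rsubmx (u (rshift 1 i) b *m O)).
  rewrite mulr_sumr; apply: eq_bigr => s2 _; set s := [ffun i => _].
  have sl : s 0 = a by rewrite e0 /s ffunE (unsplitK (inl 0)) ffunE.
  have sr i : s (rshift 1 i) = s2 i by rewrite /s ffunE (unsplitK (inr i)).
  rewrite big_split_ord /= big_ord1 -e0 sl.
  under eq_bigr do rewrite sr.
  have -> : \det (\matrix_i u i (s i)) ^+ 2 =
            sqnorm (u 0 a) * \det (\matrix_i rsubmx (u (rshift 1 i) (s2 i) *m O)) ^+ 2.
    set M := \matrix_i u i (s i).
    have <- : \det (M *m O) ^+ 2 = \det M ^+ 2.
      by rewrite det_mulmx exprMn (det_orthogonal_sqr hO) mulr1.
    have rM i : row i (M *m O) = u i (s i) *m O by rewrite row_mul rowK.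
    have -> : M *m O = block_mx r%:M 0 (dlsubmx (M *m O)) (drsubmx (M *m O)).
      have rME j : (M *m O) 0 j = (u 0 a *m O) 0 j.
        by have := rM 0; rewrite sl => <-; rewrite [RHS]mxE.
      rewrite -[LHS]submxK; congr block_mx; apply/matrixP => i j; rewrite !ord1.
        by rewrite [LHS]mxE [LHS]mxE -e0 rME hu e0 row_mxEl.
      by rewrite [LHS]mxE [LHS]mxE -e0 rME hu row_mxEr.
    rewrite det_lblock det_scalar1 exprMn hr; congr (_ * \det _ ^+ 2).
    apply/row_matrixP => i; rewrite rowK -sr -rM; apply/matrixP => x y.
    by rewrite !mxE.
  ring.
apply: ler_wpM2l; last exact: hc.
by rewrite mulr_ge0 // -tail0 tail_ge0.
Qed.

(** The preimage of a [k]-dimensional subspace under the projection has dimension [k + 1]. Hence the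
    hypothesis compares as many classes as dimensions, one class fewer than [spread] does. *)
Lemma spread_project (R : realFieldType) (m : nat) (T : finType)
    (mu : 'I_(1 + m) -> T -> R) (u : 'I_(1 + m) -> T -> 'rV[R]_(1 + m)) (e : R) :
  (forall (S : {set 'I_(1 + m)}) (O : 'M[R]_(1 + m)) k, O *m O^T = 1%:M -> #|S| = k ->
    (0 < k < 1 + m)%N ->
     e <= \sum_(i in S) \sum_a mu i a * tail k (u i a *m O)) ->
  forall O : 'M[R]_(1 + m), O *m O^T = 1%:M ->
  spread (fun i => mu (rshift 1 i)) (fun i b => rsubmx (u (rshift 1 i) b *m O)) e.
Proof.
move=> h O hO S O' k hO' hS.
pose O2 := O *m block_mx (1%:M : 'M_1) 0 0 O'.
have hO2 : O2 *m O2^T = 1%:M.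
  rewrite trmx_mul mulmxA -(mulmxA O) orthogonal_block ?mulmx1 //.
  by rewrite trmx1 mulmx1.
have hk : (k.+1 <= m)%N by rewrite -hS -[m in (_ <= m)%N]card_ord max_card.
apply: le_trans (h (@rshift 1 m @: S) O2 k.+1 hO2 _ _) _.
- by rewrite (card_imset _ (@rshift_inj _ _)).
- by rewrite ltnS.
rewrite big_imset /=; last by move=> i j _ _; exact: rshift_inj.
apply: ler_sum => i _; apply: ler_sum => a _.
rewrite /O2 mulmxA; set v := u _ a *m O.
rewrite (tail_row_mx_r k (v *m _)) -[v in leLHS]hsubmxK mul_row_block !mulmx0.
by rewrite add0r row_mxKr.
Qed.

Lemma perm_of_card (k l : nat) (S : {set 'I_(k + l)}) : #|S| = k ->
  exists p : 'S_(k + l), forall i, p (lshift l i) \in S.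
Proof.
move=> hS.
have hC : #|~: S| = l by rewrite cardsCs finset.setCK hS card_ord addKn.
pose f (i : 'I_(k + l)) : 'I_(k + l) := match split i with
  | inl j => enum_val (cast_ord (esym hS) j) | inr j => enum_val (cast_ord (esym hC) j) end.
have f_inj : injective f.
  move=> i j; rewrite /f; case: split_ordP => i' ->; case: split_ordP => j' -> h.
  - by have := enum_val_inj h => /cast_ord_inj ->.
  - have := enum_valP (cast_ord (esym hS) i').
    by rewrite h; have := enum_valP (cast_ord (esym hC) j'); rewrite inE => /negbTE ->.
  - have := enum_valP (cast_ord (esym hS) j').
    by rewrite -h; have := enum_valP (cast_ord (esym hC) i'); rewrite inE => /negbTE ->.
  - by have := enum_val_inj h => /cast_ord_inj ->.
exists (perm f_inj) => i; rewrite permE /f (unsplitK (inl i)); exact: enum_valP.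
Qed.

(* Rado's theorem, quantitatively.  If some [k] classes nearly lie in a [k]-dimensional
   subspace, the matrix is nearly block triangular and both diagonal blocks are again
   spread; otherwise, projecting along any vector of the first class keeps the other
   classes spread. *)
Lemma edet2_lower_bound (R : rcfType) (D : nat) (e : R) : 0 < e ->
  exists2 c : R, 0 < c & forall m (T : finType) (mu : 'I_m -> T -> R) u, (m <= D)%N ->
    (forall i a, 0 <= mu i a) -> (forall i, \sum_a mu i a = 1) ->
    (forall i a, sqnorm (u i a) <= 1) -> spread mu u e -> c <= edet2 mu u.
Proof.
have base (T : finType) (mu : 'I_0 -> T -> R) u : 1 <= edet2 mu u.
  rewrite /edet2 (eq_bigr (fun=> 1)) => [|s _]; last first.
    by rewrite big_ord0 det_mx00 expr1n mulr1.
  by rewrite sumr_const card_ffun card_ord expn0.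
elim: D e => [|D IH] e e0.
  by exists 1 => // m T mu u; rewrite leqn0 => /eqP m0; subst m => *; exact: base.
have [|c1 c1_gt0 hc1] := IH (e / 2); first by rewrite divr_gt0.
pose L : R := (D.+1)`!%:R ^+ 2 * (D.+1 * D.+1)%:R.
have L0 : 0 < L by rewrite mulr_gt0 ?exprn_gt0 ?ltr0n ?fact_gt0 ?muln_gt0.
(* The first bound keeps both blocks [e / 2]-spread after subtracting the defect; the second keeps
   the error of [edet2_block] below half of its main term [c1 ^+ 2 / 2]. *)
pose eta := Num.min (e / 2) (c1 ^+ 2 / (4 * L)).
have eta0 : 0 < eta.
  by rewrite lt_min (divr_gt0 e0) // divr_gt0 ?exprn_gt0 // mulr_gt0.
have [|c2 c2_gt0 hc2] := IH eta => //.
(* The three entries serve the empty matrix, the block triangular case and the projection case. *)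
pose c := Num.min 1 (Num.min (c1 ^+ 2 / 4) (e * c2)).
have c_gt0 : 0 < c by rewrite !lt_min ltr01 (mulr_gt0 e0) // divr_gt0 // exprn_gt0.
exists c => // m T mu u mD mu0 mu1 u1 hs.
case: m mD mu u mu0 mu1 u1 hs => [|m] mD mu u mu0 mu1 u1 hs.
  by apply: le_trans (base _ _ _); rewrite /c ge_min lexx.
have [[S [O [k [hO hS hk ht]]]]|hn] := EM (exists (S : {set 'I_m.+1}) (O : 'M[R]_m.+1) k,
    [/\ O *m O^T = 1%:M, #|S| = k, (0 < k < m.+1)%N &
     \sum_(i in S) \sum_a mu i a * tail k (u i a *m O) < eta]).
  have [l [hl l0]] : exists l, m.+1 = (k + l)%N /\ (0 < l)%N.
    by exists (m.+1 - k)%N; case/andP: hk => *; split; lia.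
  case/andP: hk => k0 _.
  move: mD mu u mu0 mu1 u1 hs S O hO hS ht; rewrite hl => mD mu u mu0 mu1 u1 hs S O hO hS ht.
  have [p hp] := perm_of_card hS.
  pose mu' i := mu (p i); pose u' i a := u (p i) a *m O.
  have -> : edet2 mu u = edet2 mu' u' by rewrite edet2_rotate // edet2_perm.
  have hs' : spread mu' u' e by apply: spread_rotate => //; exact: spread_perm.
  have u1' i a : sqnorm (u' i a) <= 1 by rewrite sqnorm_orthogonal.
  have mu0' i a : 0 <= mu' i a by exact: mu0.
  have mu1' i : \sum_a mu' i a = 1 by exact: mu1.
  have hb := edet2_block mu0' mu1' u1'.
  have sl := spread_l mu0' hs'; have sr := spread_r mu0' hs'.
  move: hb sl sr; set d := \sum_(i < k) _ => hb sl sr.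
  have hd : d < eta.
    apply: le_lt_trans ht; rewrite /d.
    pose F i := \sum_a mu i a * tail k (u i a *m O).
    have himg : (p \o lshift l) @: 'I_k \subset S.
      by apply/fintype.subsetP => i /imsetP[j _ ->]; exact: hp.
    rewrite (big_setID ((p \o lshift l) @: 'I_k)) /= (finset.setIidPr himg) big_imset /=;
      last first.
      by move=> i j _ _ /perm_inj /lshift_inj.
    by rewrite lerDl sumr_ge0 // => i _; rewrite sumr_ge0 // => a _;
      rewrite mulr_ge0 ?tail_ge0.
  have de : e / 2 <= e - d.
    have : eta <= e / 2 by rewrite /eta ge_min lexx.
    lra.
  have weaken n (w : 'I_n -> T -> R) x : spread w x (e - d) -> spread w x (e / 2).
    by move=> h S' O' k' hO' hS'; apply: le_trans de _; exact: h.
  have hl1 := hc1 _ _ _ _ _ _ _ _ (weaken _ _ _ sl).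
  have hr1 := hc1 _ _ _ _ _ _ _ _ (weaken _ _ _ sr).
  set E1 := edet2 _ _ in hb hl1; set E2 := edet2 _ _ in hb hr1.
  have {}hl1 : c1 <= E1.
    apply: hl1 => //; first by lia.
    by move=> i a; apply: le_trans (u1' (lshift l i) a);
      rewrite sqnorm_row_mx lerDl -tail0 tail_ge0.
  have {}hr1 : c1 <= E2.
    apply: hr1 => //; first by lia.
    by move=> i a; apply: le_trans (u1' (rshift k i) a);
      rewrite sqnorm_row_mx lerDr -tail0 tail_ge0.
  have hE : c1 ^+ 2 <= E1 * E2 by rewrite expr2 ler_pM // ltW.
  have hL : (k + l)`!%:R ^+ 2 * (k * l)%:R * d <= c1 ^+ 2 / 4.
    have d0 : 0 <= d.
      by rewrite sumr_ge0 // => i _; rewrite sumr_ge0 // => a _; rewrite mulr_ge0 ?tail_ge0.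
    apply: (@le_trans _ _ (L * eta)).
      apply: ler_pM => //; last exact: ltW.
        by rewrite mulr_ge0 // sqr_ge0.
      apply: ler_pM; [exact: sqr_ge0|exact: ler0n| |].
        by rewrite lerXn2r ?nnegrE ?ler0n // ler_nat; apply: leq_fact.
      rewrite ler_nat; apply: leq_mul; apply: leq_trans mD; [exact: leq_addr|exact: leq_addl].
    have : eta <= c1 ^+ 2 / (4 * L) by rewrite /eta ge_min lexx orbT.
    rewrite -(ler_pM2l L0) => /le_trans; apply.
    by rewrite le_eqVlt; apply/orP; left; apply/eqP; field; rewrite gt_eqF.
  apply: le_trans hb; apply: (@le_trans _ _ (c1 ^+ 2 / 4)).
    by rewrite /c !ge_min lexx orbT.
  lra.
have hP (S : {set 'I_(1 + m)}) (O : 'M[R]_(1 + m)) k : O *m O^T = 1%:M -> #|S| = k ->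
    (0 < k < 1 + m)%N -> eta <= \sum_(i in S) \sum_a mu i a * tail k (u i a *m O).
  move=> hO hS hk; rewrite leNgt; apply/negP => h; apply: hn.
  by exists S, O, k.
(* This is the spread condition for a single class and the zero subspace. *)
have hfirst : e <= \sum_a mu 0 a * sqnorm (u 0 a).
  have := hs [set 0]%SET 1%:M 0; rewrite trmx1 mulmx1 finset.cards1 => /(_ erefl erefl).
  by rewrite finset.big_set1; under eq_bigr do rewrite mulmx1 tail0.
apply: (@le_trans _ _ (e * c2)); first by rewrite /c !ge_min lexx !orbT.
apply: (@le_trans _ _ ((\sum_a mu 0 a * sqnorm (u 0 a)) * c2)).
  by rewrite ler_wpM2r // ltW.
apply: (@edet2_split_first _ m) => // O hO; apply: hc2 => //.
- move=> i a; apply: le_trans (u1 (rshift 1 i) a).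
  by rewrite -(sqnorm_orthogonal (u (rshift 1 i) a) hO) (@sqnorm_row_mx _ 1 m) lerDr -tail0
    tail_ge0.
- exact: spread_project.
Qed.

(** * Isotropic position *)

(* [unitize 0 = 0]. *)
Definition unitize (R : rcfType) (D : nat) (u : 'rV[R]_D) : 'rV[R]_D :=
  (Num.sqrt (sqnorm u))^-1 *: u.

Lemma sqnorm_ge0 (R : realDomainType) (D : nat) (u : 'rV[R]_D) : 0 <= sqnorm u.
Proof. by rewrite -tail0 tail_ge0. Qed.

Lemma sqnorm_eq0 (R : realDomainType) (D : nat) (u : 'rV[R]_D) :
  (sqnorm u == 0) = (u == 0).
Proof.
apply/eqP/eqP => [h|->]; last by apply: big1 => j _; rewrite mxE expr0n.
apply/matrixP => i j; rewrite ord1 mxE; apply/eqP; rewrite -sqrf_eq0; apply/eqP.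
by apply: (psumr_eq0P _ h) => // ? _; exact: sqr_ge0.
Qed.

Lemma sqnormZ (R : comNzRingType) (D : nat) (c : R) (u : 'rV[R]_D) :
  sqnorm (c *: u) = c ^+ 2 * sqnorm u.
Proof. by rewrite mulr_sumr; apply: eq_bigr => j _; rewrite mxE exprMn. Qed.

Lemma sqnorm_unitize (R : rcfType) (D : nat) (u : 'rV[R]_D) :
  u != 0 -> sqnorm (unitize u) = 1.
Proof.
move=> u0; rewrite sqnormZ exprVn sqr_sqrtr ?sqnorm_ge0 // mulVf //.
by rewrite sqnorm_eq0.
Qed.

(** A weak Hadamard inequality: each of the [D!] Leibniz terms is at most the product of the row
    norms. *)
Lemma det_sqr_le_sqnorm (R : rcfType) (D : nat) (M : 'M[R]_D) :
  \det M ^+ 2 <= D`!%:R ^+ 2 * \prod_i sqnorm (row i M).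
Proof.
pose r i := Num.sqrt (sqnorm (row i M)).
have hr i j : `|M i j| <= r i.
  rewrite -sqrtr_sqr ler_sqrt ?sqnorm_ge0 //.
  have -> : M i j = row i M 0 j by rewrite mxE.
  by rewrite /sqnorm (bigD1 j) //= lerDl sumr_ge0 // => ? _; exact: sqr_ge0.
have -> : \prod_i sqnorm (row i M) = (\prod_i r i) ^+ 2.
  by rewrite -prodrXl; apply: eq_bigr => i _; rewrite sqr_sqrtr ?sqnorm_ge0.
rewrite -exprMn -[leLHS]real_normK ?num_real //.
have r0 : 0 <= \prod_i r i by apply: prodr_ge0 => i _; exact: sqrtr_ge0.
rewrite lerXn2r ?nnegrE ?mulr_ge0 ?ler0n //.
apply: le_trans (ler_norm_sum _ _ _) _.
have <- : #|{: 'S_D}| = D`! by rewrite card_Sn.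
rewrite mulr_natl -sumr_const; apply: ler_sum => /= s _.
rewrite normrM normrX normrN1 expr1n mul1r normr_prod.
by apply: ler_prod => i _; rewrite normr_ge0 hr.
Qed.

Definition mean (R : realFieldType) (T : finType) (A : {set T}) (f : T -> R) : R :=
  (\sum_(a in A) f a) / #|A|%:R.

Lemma mean_le (R : realFieldType) (T : finType) (A : {set T}) (f g : T -> R) :
  (forall a, a \in A -> f a <= g a) -> mean A f <= mean A g.
Proof. by move=> h; rewrite ler_wpM2r ?invr_ge0 ?ler0n // ler_sum. Qed.

Lemma mean_cst (R : realFieldType) (T : finType) (A : {set T}) (c : R) :
  A != finset.set0 -> mean A (fun=> c) = c.
Proof.
move=> A0; rewrite /mean sumr_const -[c *+ _]mulr_natr. rewrite mulfK //.
by rewrite pnatr_eq0 cards_eq0.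
Qed.

Lemma meanD (R : realFieldType) (T : finType) (A : {set T}) (f g : T -> R) :
  mean A (fun a => f a + g a) = mean A f + mean A g.
Proof. by rewrite /mean big_split mulrDl. Qed.

Lemma meanZ (R : realFieldType) (T : finType) (A : {set T}) (c : R) (f : T -> R) :
  mean A (fun a => c * f a) = c * mean A f.
Proof. by rewrite /mean -mulr_sumr mulrA. Qed.

Lemma ln_prod (R : realType) (I : finType) (f : I -> R) :
  (forall i, 0 < f i) -> ln (\prod_i f i) = \sum_i ln (f i).
Proof.
move=> f0; suff: 0 < \prod_i f i /\ ln (\prod_i f i) = \sum_i ln (f i) by case.
apply: (big_ind2 (fun x y => 0 < x /\ ln x = y)) => [|x1 x2 y1 y2 [h1 e1] [h2 e2]|i _].
- by rewrite ltr01 ln1.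
- by rewrite mulr_gt0 // lnM ?posrE // e1 e2.
- by [].
Qed.

Section Forster.
Variables (R : realType) (D : nat) (T : finType) (v : T -> 'rV[R]_D) (B : 'I_D -> {set T}).
Hypothesis B0 : forall i, B i != finset.set0.
Hypothesis vB : forall s : {ffun 'I_D -> T}, (forall i, s i \in B i) ->
  \det (\matrix_i v (s i)) != 0.

Lemma transversal_through i a : a \in B i ->
  exists2 s : {ffun 'I_D -> T}, forall j, s j \in B j & s i = a.
Proof.
move=> aB; have hx j : exists x, x \in B j by apply/set0Pn.
pose s := [ffun j => if j == i then a else xchoose (hx j)].
exists s => [j|]; rewrite ffunE ?eqxx //.
by case: eqP => [->|_] //; exact: xchooseP.
Qed.

Lemma row_det_neq0 (M : 'M[R]_D) i : \det M != 0 -> row i M != 0.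
Proof.
rewrite -unitfE -unitmxE -row_free_unit => /row_freeP [N hN].
apply/eqP => h; have := congr1 (row i) hN.
rewrite row_mul h mul0mx => /matrixP /(_ 0 i); rewrite !mxE eqxx => /eqP.
by rewrite eq_sym oner_eq0.
Qed.

Lemma transversal_neq0 i a (g : 'M[R]_D) : a \in B i -> g \in unitmx -> v a *m g != 0.
Proof.
move=> aB ug; have [s hs sa] := transversal_through aB.
have <- : row i ((\matrix_i v (s i)) *m g) = v a *m g by rewrite row_mul rowK sa.
apply: row_det_neq0; rewrite det_mulmx mulf_neq0 ?vB //.
by rewrite -unitfE -unitmxE.
Qed.

(** Scaling [g] or multiplying it on the right by an orthogonal matrix leaves this potential
    unchanged on invertible matrices. *)
Let Psi (g : 'M[R]_D) : R :=
  \sum_i mean (B i) (fun a => ln (sqnorm (v a *m g))) - ln (\det g ^+ 2).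

(** Take the transversal [s] of the shortest vectors [v a *m g] in each class. The averages dominate
    the logarithms for [s], and Hadamard's inequality bounds the product of these lengths below by
    [\det g] times the determinant of [s], which is one of finitely many nonzero numbers. *)
Lemma log_potential_bounded : exists b, forall g, g \in unitmx -> b <= Psi g.
Proof.
pose m := \sum_(s : {ffun 'I_D -> T}) `|ln (\det (\matrix_i v (s i)) ^+ 2)|.
exists (- m - ln (D`!%:R ^+ 2)) => g ug.
have hx i : exists x, x \in B i by apply/set0Pn.
pose s := [ffun i => [arg min_(a < xchoose (hx i) in B i) sqnorm (v a *m g)]%O].
have [sB smin] : (forall i, s i \in B i) /\
    (forall i a, a \in B i -> sqnorm (v (s i) *m g) <= sqnorm (v a *m g)).
  split=> i; rewrite ffunE; case: arg_minP => [|j jB h]; rewrite ?(xchooseP (hx i)) //.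
have dg : 0 < \det g ^+ 2 by rewrite exprn_even_gt0 //= -unitfE -unitmxE.
have dv : 0 < \det (\matrix_i v (s i)) ^+ 2 by rewrite exprn_even_gt0 //= vB.
have Df : 0 < D`!%:R ^+ 2 :> R by rewrite exprn_gt0 // ltr0n fact_gt0.
have pos i : 0 < sqnorm (v (s i) *m g).
  by rewrite lt_def sqnorm_ge0 andbT sqnorm_eq0 (transversal_neq0 (sB i)).
have h1 : ln (\prod_i sqnorm (v (s i) *m g)) <=
    \sum_i mean (B i) (fun a => ln (sqnorm (v a *m g))).
  rewrite ln_prod //; apply: ler_sum => i _.
  rewrite -[leLHS](mean_cst _ (B0 i)); apply: mean_le => a aB.
  by rewrite ler_ln ?posrE // ?smin // (lt_le_trans (pos i)) // smin.
have h2 : \det (\matrix_i v (s i)) ^+ 2 * \det g ^+ 2 <=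
    D`!%:R ^+ 2 * \prod_i sqnorm (v (s i) *m g).
  rewrite -exprMn -det_mulmx; apply: le_trans (det_sqr_le_sqnorm _) _.
  apply: ler_wpM2l; first exact: ltW.
  rewrite le_eqVlt; apply/orP; left; apply/eqP.
  by apply: eq_bigr => i _; rewrite row_mul rowK.
have h3 : ln (\det (\matrix_i v (s i)) ^+ 2) + ln (\det g ^+ 2) <=
    ln (D`!%:R ^+ 2) + ln (\prod_i sqnorm (v (s i) *m g)).
  have p0 : 0 < \prod_i sqnorm (v (s i) *m g) by apply: prodr_gt0.
  by rewrite -!lnM ?posrE // ler_ln ?posrE; [exact: h2|rewrite mulr_gt0|rewrite mulr_gt0].
have h4 : - m <= ln (\det (\matrix_i v (s i)) ^+ 2).
  rewrite lerNl; apply: le_trans (ler_norm _) _; rewrite normrN.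
  by rewrite /m (bigD1 s) //= lerDl sumr_ge0.
rewrite /Psi; lra.
Qed.

Let u (g : 'M[R]_D) a := unitize (v a *m g).

(** The difference [Psi (g *m h) - Psi g] is the potential at [h] of the normalized vectors [u g a],
    so it suffices that [Psi g] is within [e] of the infimum. *)
Lemma near_minimizer (e : R) : 0 < e -> exists2 g, g \in unitmx &
  forall h, h \in unitmx ->
    ln (\det h ^+ 2) - e <= \sum_i mean (B i) (fun a => ln (sqnorm (u g a *m h))).
Proof.
move=> e0; have [b hb] := log_potential_bounded.
pose E := [set Psi g | g in [set g : 'M[R]_D | g \in unitmx]]%classic.
have hE : has_inf E.
  split; first by exists (Psi 1%:M), 1%:M => //=; exact: unitmx1.
  by exists b => _ [g ug <-]; exact: hb.
have [_ [g ug <-] hg] := inf_adherent e0 hE.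
exists g => // h uh.
have hgh : inf E <= Psi (g *m h).
  by apply: ge_inf; [exact: hE.2|exists (g *m h) => //=; rewrite unitmx_mul ug].
have sq_gt0 (M : 'M[R]_D) : M \in unitmx -> 0 < \det M ^+ 2.
  by move=> uM; rewrite exprn_even_gt0 //= -unitfE -unitmxE.
have hsum : \sum_i mean (B i) (fun a => ln (sqnorm (v a *m (g *m h)))) =
   \sum_i mean (B i) (fun a => ln (sqnorm (v a *m g))) +
   \sum_i mean (B i) (fun a => ln (sqnorm (u g a *m h))).
  rewrite -big_split /=; apply: eq_bigr => i _; rewrite -meanD /mean; congr (_ / _).
  apply: eq_bigr => a aB.
  have p1 : 0 < sqnorm (v a *m g).
    by rewrite lt_def sqnorm_ge0 andbT sqnorm_eq0 (transversal_neq0 aB).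
  have p2 : 0 < sqnorm (v a *m g *m h).
    by rewrite -mulmxA lt_def sqnorm_ge0 andbT sqnorm_eq0 (transversal_neq0 aB) //
      unitmx_mul ug.
  have eq : sqnorm (v a *m (g *m h)) = sqnorm (v a *m g) * sqnorm (u g a *m h).
    rewrite /u /unitize -scalemxAl sqnormZ exprVn sqr_sqrtr ?sqnorm_ge0 // mulrA.
    by rewrite divff ?gt_eqF // mul1r mulmxA.
  rewrite eq lnM ?posrE // -(pmulr_rgt0 _ p1) -eq mulmxA //.
move: hgh hg; rewrite /Psi hsum det_mulmx exprMn lnM ?posrE ?sq_gt0 //; lra.
Qed.

(* Compare [g] with [g *m h], where [h] stretches the last [D - k] directions of the basis
   [O] by a factor [1 + t]. *)
Lemma forster : exists2 g, g \in unitmx & forall (O : 'M[R]_D) k, O *m O^T = 1%:M ->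
  (k <= D)%N ->
  D%:R - k%:R - 2^-1 <= \sum_i mean (B i) (fun a => tail k (unitize (v a *m g) *m O)).
Proof.
pose t : R := (8 * D.+1%:R)^-1.
have t0 : 0 < t by rewrite invr_gt0 mulr_gt0 // ltr0n.
have t2 : 0 < t / 2 by rewrite divr_gt0.
have [g ug hg] := near_minimizer t2.
exists g => // O k hO kD.
pose d : 'rV[R]_D := \row_j (if (k <= j)%N then 1 + t else 1).
pose h := O *m diag_mx d.
have t1 : 0 < 1 + t by lra.
have dh : \det h ^+ 2 = (1 + t) ^+ (D - k) ^+ 2.
  rewrite det_mulmx exprMn det_orthogonal_sqr // mul1r det_diag; congr (_ ^+ 2).
  under eq_bigr do rewrite mxE.
  rewrite -big_mkcond /= -prodr_const_nat big_geq_mkord; exact: eq_bigl.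
have uh : h \in unitmx by rewrite unitmxE unitfE -sqrf_eq0 dh !expf_eq0 /= (gt_eqF t1) andbF.
have := hg h uh.
set X := \sum_i mean (B i) (fun a => tail k _).
(* Stretching a unit vector raises its squared norm by [(1 + t) ^+ 2 - 1] times its tail; then
   [ln (1 + x) <= x]. *)
have hX : \sum_i mean (B i) (fun a => ln (sqnorm (u g a *m h))) <= ((1 + t) ^+ 2 - 1) * X.
  rewrite mulr_sumr; apply: ler_sum => i _; rewrite -meanZ; apply: mean_le => a aB.
  have un : sqnorm (u g a *m O) = 1.
    by rewrite sqnorm_orthogonal // sqnorm_unitize // (transversal_neq0 aB).
  have -> : sqnorm (u g a *m h) = 1 + ((1 + t) ^+ 2 - 1) * tail k (u g a *m O).
    rewrite -[X in _ = X + _]un /sqnorm /tail mulmxA; move: (u g a *m O) => w.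
    rewrite mulr_sumr [X in _ = _ + X]big_mkcond -big_split /=.
    apply: eq_bigr => j _; rewrite mul_mx_diag !mxE.
    by case: ifP => _; ring.
  apply: le_ln1Dx; apply: (@lt_le_trans _ _ 0); first by rewrite ltrN10.
  by rewrite mulr_ge0 ?tail_ge0 // subr_ge0 exprn_ege1 //; lra.
have lt : t / (1 + t) <= ln (1 + t).
  rewrite -[leRHS]opprK -lnV ?posrE // lerNr.
  have E : (1 + t)^-1 = 1 + - (t / (1 + t)) by field; rewrite gt_eqF.
  rewrite [X in ln X]E.
  by apply: le_ln1Dx; rewrite ltrN2 ltr_pdivrMr // mul1r; lra.
have ld : 2 * (D - k)%:R * (t / (1 + t)) <= ln (\det h ^+ 2).
  rewrite dh -exprM lnXn // -[leRHS]mulr_natr natrM mulrC [X in _ <= _ * X]mulrC.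
  by rewrite ler_wpM2r // mulr_ge0.
set y : R := (D - k)%:R in ld *; rewrite -natrB // -/y => hX2.
have y0 : 0 <= y by rewrite ler0n.
have tN : D.+1%:R * t = 8^-1 by rewrite /t invfM mulrCA divff ?mulr1 // pnatr_eq0.
have yt : y * t <= 8^-1.
  have : y <= D.+1%:R by rewrite ler_nat leqW // leq_subr.
  rewrite -(ler_pM2r t0) => /le_trans; apply.
  by rewrite tN.
have tle : t <= 8^-1.
  have : 1 <= D.+1%:R :> R by rewrite ler1n.
  rewrite -(ler_pM2r t0) mul1r => /le_trans; apply.
  by rewrite tN.
have hz : t / (1 + t) * (1 + t) = t by rewrite divfK // gt_eqF.
move: (t / (1 + t)) hz lt ld => z hz lt ld.
(* If [X < y - 1/2], division by [t] leaves a gap of [1/2] between the leading terms, while the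
   higher order terms amount to at most [3/8 + 1/64]. The factor 8 in [t] is chosen for this. *)
rewrite leNgt; apply/negP => hlt.
have h1 : 2 * y * z - t / 2 <= ((1 + t) ^+ 2 - 1) * X by lra.
have h2 : ((1 + t) ^+ 2 - 1) * X < ((1 + t) ^+ 2 - 1) * (y - 2^-1).
  by rewrite ltr_pM2l //; nra.
have h3 : 2 * y * z * (1 + t) = 2 * y * t by rewrite -mulrA hz.
have h4 : (2 * y * z - t / 2) * (1 + t) < ((1 + t) ^+ 2 - 1) * (y - 2^-1) * (1 + t).
  by rewrite ltr_pM2r //; lra.
have h5 : 0 < t * (y * (3 * t + t ^+ 2) - 2^-1 - t - t ^+ 2 / 2) by nra.
have h6 : y * (3 * t + t ^+ 2) <= 3 / 8 + 8^-1 * 8^-1 by nra.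
move: h5; rewrite pmulr_rgt0 //; nra.
Qed.
End Forster.

(** * Cells with a common point *)

Definition in_cone (R : numDomainType) (D : nat) (T : Type) (v : T -> 'rV[R]_D)
    (s : 'I_D -> T) (x : 'rV[R]_D) : Prop :=
  exists2 w : 'I_D -> R, forall i, 0 < w i & x = \sum_i w i *: v (s i).

(** Open cones do not change when generators are rescaled by positive factors, and they are carried
    along by linear bijections. *)
Lemma in_cone_unitize (R : rcfType) (D : nat) (T : Type) (v : T -> 'rV[R]_D)
    (g : 'M[R]_D) (s : 'I_D -> T) x :
  g \in unitmx -> (forall i, v (s i) *m g != 0) ->
  in_cone (fun a => unitize (v a *m g)) s x -> in_cone v s (x *m invmx g).
Proof.
move=> ug h [w w0 ->].
exists (fun i => w i * (Num.sqrt (sqnorm (v (s i) *m g)))^-1) => [i|].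
  by rewrite mulr_gt0 // invr_gt0 sqrtr_gt0 lt_def sqnorm_eq0 h sqnorm_ge0.
rewrite mulmx_suml; apply: eq_bigr => i _.
by rewrite /unitize scalerA -scalemxAl mulmxK.
Qed.

Lemma adj_sub_le (R : realDomainType) (D : nat) (M N : 'M[R]_D) (e : R) i j :
  (forall i j, `|M i j| <= 1) -> (forall i j, `|N i j| <= 1) ->
  (forall i j, `|M i j - N i j| <= e) ->
  `|(\adj M) i j - (\adj N) i j| <= D`!%:R * (D * D)%:R * e.
Proof.
move=> hM hN he; rewrite !mxE /cofactor -mulrBr normrM normrX normrN1 expr1n mul1r.
apply: le_trans (det_sub_le _ _) _ => [a b|a b|]; rewrite ?mxE //.
have e0 : 0 <= e by apply: le_trans (he i j).
rewrite -mulrA; apply: ler_pM => //.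
- by rewrite sumr_ge0 // => a _; rewrite sumr_ge0.
- by rewrite ler_nat leq_fact // leq_pred.
apply: (@le_trans _ _ (\sum_(a < D.-1) \sum_(b < D.-1) e)).
  by apply: ler_sum => a _; apply: ler_sum => b _; rewrite !mxE.
rewrite !sumr_const !card_ord -mulrnA -[leLHS]mulr_natl ler_wpM2r // ler_nat.
by rewrite leq_mul // leq_pred.
Qed.

(** By Cramer's rule, the coordinates of the row sum of [M] in the rows of [N] are quotients whose
    numerator and denominator both lie within [c / 4] of [\det M], hence have the same sign. *)
Lemma close_in_cone (R : realFieldType) (D : nat) (M N : 'M[R]_D) (c e : R) :
  (forall i j, `|M i j| <= 1) -> (forall i j, `|N i j| <= 1) ->
  (forall i j, `|M i j - N i j| <= e) -> 0 < c -> c <= `|\det M| ->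
  D`!%:R * (D * D)%:R * e * (D * D)%:R <= c / 4 ->
  exists2 w : 'I_D -> R, forall i, 0 < w i & \sum_i row i M = \sum_i w i *: row i N.
Proof.
case: D M N => [|D] M N hM hN he c0 hc hsmall.
  by exists (fun=> 1) => [[]//|]; rewrite !big_ord0.
set d := D.+1 in M N hM hN he hc hsmall *.
have e0 : 0 <= e by apply: le_trans (he 0 0).
set B := _ * e in hsmall.
have B0 : 0 <= B by rewrite !mulr_ge0 ?ler0n.
have BB : B <= c / 4.
  by apply: le_trans hsmall; rewrite ler_peMr // ler1n muln_gt0.
have hdet : `|\det M - \det N| <= c / 4.
  apply: le_trans BB; apply: le_trans (det_sub_le hM hN) _.
  rewrite /B -mulrA ler_wpM2l //.
  apply: (@le_trans _ _ (\sum_(i < d) \sum_(j < d) e)).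
    by apply: ler_sum => i _; apply: ler_sum.
  by rewrite !sumr_const !card_ord -mulrnA -[leLHS]mulr_natl.
pose x := \sum_i row i M.
have xE : x = (const_mx 1 : 'rV_d) *m M.
  apply/matrixP => i j; rewrite summxE mxE; apply: eq_bigr => k _.
  by rewrite !mxE mul1r.
have hx j : `|x 0 j| <= d%:R.
  rewrite summxE; apply: le_trans (ler_norm_sum _ _ _) _.
  have -> : d%:R = \sum_(i < d) (1 : R) by rewrite sumr_const card_ord.
  by apply: ler_sum => i _; rewrite mxE.
have hadj i : `|\det M - (x *m \adj N) 0 i| <= c / 4.
  have -> : \det M = (x *m \adj M) 0 i.
    by rewrite xE -mulmxA mul_mx_adj mul_mx_scalar !mxE mulr1.
  rewrite ![(_ *m _) _ _]mxE -sumrB.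
  apply: le_trans hsmall; apply: le_trans (ler_norm_sum _ _ _) _.
  apply: (@le_trans _ _ (\sum_(j < d) d%:R * B)).
    apply: ler_sum => j _; rewrite -mulrBr normrM ler_pM //.
    exact: adj_sub_le.
  by rewrite sumr_const card_ord -[leLHS]mulr_natl mulrA -natrM mulrC.
have dN0 : \det N != 0.
  apply/eqP => dN; move: hdet; rewrite dN subr0; lra.
have uN : N \in unitmx by rewrite unitmxE unitfE.
exists (fun i => (x *m invmx N) 0 i) => [i|].
  have -> : (x *m invmx N) 0 i = (\det N)^-1 * (x *m \adj N) 0 i.
    by rewrite /invmx uN -scalemxAr mxE.
  move: (hadj i) hdet hc; move: ((x *m \adj N) 0 i) (\det N) (\det M) => p b a.
  rewrite !ler_norml => /andP[h1 h2] /andP[h3 h4].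
  have [a0|a0] := leP 0 a.
    rewrite ger0_norm // => ac; rewrite mulr_gt0 ?invr_gt0 //; lra.
  rewrite ltr0_norm // => ac; rewrite nmulr_rgt0 ?invr_lt0 //; lra.
rewrite -/x -[LHS](mulmxKV uN) mulmx_sum_row.
by apply: eq_bigr.
Qed.

Lemma sqnorm_unitize_le1 (R : rcfType) (D : nat) (u : 'rV[R]_D) : sqnorm (unitize u) <= 1.
Proof.
have [->|u0] := eqVneq u 0; last by rewrite sqnorm_unitize.
by rewrite /unitize scaler0 /sqnorm big1 // => j _; rewrite mxE expr0n.
Qed.

Lemma tail_le_sqnorm (R : realDomainType) (D k : nat) (u : 'rV[R]_D) : tail k u <= sqnorm u.
Proof.
rewrite /sqnorm (bigID (fun j : 'I_D => (k <= j)%N)) /= lerDl.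
by apply: sumr_ge0 => j _; exact: sqr_ge0.
Qed.

(** * Uniform measures on boxes and good cells *)

Definition uniform (R : realFieldType) (I T : finType) (B : I ->
  {set T}) (i : I) (a : T) : R :=
  (a \in B i)%:R / #|B i|%:R.

Lemma sum_uniform (R : realFieldType) (I T : finType) (B : I -> {set T}) i (f : T -> R) :
  \sum_a uniform R B i a * f a = mean (B i) f.
Proof.
rewrite /mean mulr_suml [RHS]big_mkcond; apply: eq_bigr => a _.
by rewrite /uniform; case: ifP => _; rewrite ?mul0r // mul1r mulrC.
Qed.

Definition box (I T : finType) (B : I -> {set T}) : {set {ffun I -> T}} :=
  [set s : {ffun I -> T} | [forall i, s i \in B i]]%SET.

Lemma card_box (I T : finType) (B : I -> {set T}) : #|box B| = (\prod_i #|B i|)%N.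
Proof.
have -> : #|box B| = #|family (fun i => mem (B i))|.
  by apply: eq_card => s; rewrite inE; apply/forallP/familyP.
by rewrite card_family foldrE big_map big_enum.
Qed.

(** The [D - k - 1] classes outside [S] contribute at most 1 each to a total of at least
    [D - k - 1/2], which leaves [1/2] for [S]. *)
Lemma spread_unitize (R : realType) (D : nat) (T : finType) (u : T -> 'rV[R]_D)
    (B : 'I_D -> {set T}) :
  (forall a, sqnorm (u a) <= 1) -> (forall i, B i != finset.set0) ->
  (forall (O : 'M[R]_D) k, O *m O^T = 1%:M -> (k <= D)%N ->
    D%:R - k%:R - 2^-1 <= \sum_i mean (B i) (fun a => tail k (u a *m O))) ->
  spread (uniform R B) (fun=> u) 2^-1.
Proof.
move=> u1 B0 h S O k hO hS.
have kD : (k.+1 <= D)%N by rewrite -hS -[D in (_ <= D)%N]card_ord max_card.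
under eq_bigr do rewrite sum_uniform.
have := h O k hO (ltnW kD); rewrite (bigID (mem S)) /=.
have : \sum_(i | i \notin S) mean (B i) (fun a => tail k (u a *m O)) <= D%:R - k.+1%:R.
  have -> : D%:R - k.+1%:R = \sum_(i | i \notin S) (1 : R).
    rewrite sumr_const -natrB //; congr (_%:R).
    by rewrite -[X in (X - _)%N](card_ord D) -(cardC (mem S)) -hS addKn.
  apply: ler_sum => i _; rewrite -(mean_cst 1 (B0 i)); apply: mean_le => a _.
  by apply: le_trans (tail_le_sqnorm _ _) _; rewrite sqnorm_orthogonal.
rewrite -[k.+1%:R]natr1; lra.
Qed.

Lemma edet2_uniform (R : realFieldType) (D : nat) (T : finType) (u : T -> 'rV[R]_D)
    (B : 'I_D -> {set T}) :
  edet2 (uniform R B) (fun=> u) =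
  (\sum_(s in box B) \det (\matrix_i u (s i)) ^+ 2) / #|box B|%:R.
Proof.
rewrite /edet2 mulr_suml [RHS]big_mkcond; apply: eq_bigr => s _.
rewrite inE; case: ifP => [/forallP h|/negbT].
  rewrite card_box natr_prod -prodfV mulrC; congr (_ * _).
  by apply: eq_bigr => i _; rewrite /uniform h mul1r.
rewrite negb_forall => /existsP [i hi].
by rewrite (bigD1 i) //= /uniform (negbTE hi) !mul0r.
Qed.

(** In near-isotropic position the mean squared determinant is bounded below, so many transversals
    have a large determinant. A tuple of cells is good if it contains one of these; on a fine grid
    the row sum of that transversal lies in the cones of all transversals in the same tuple of
    cells. The grid depends on [D] only. *)
Lemma good_cells (R : realType) (D : nat) :
  exists2 c : R, 0 < c & exists K : finType, forall (T : finType) (v : T -> 'rV[R]_D)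
    (B : 'I_D -> {set T}), (forall i, B i != finset.set0) ->
    (forall s, s \in box B -> \det (\matrix_i v (s i)) != 0) ->
  exists (cell : T -> K) (X : {ffun 'I_D -> K} -> 'rV[R]_D) (G : {set {ffun 'I_D -> K}}),
    (forall s, s \in box B -> [ffun i => cell (s i)] \in G ->
       in_cone v s (X [ffun i => cell (s i)])) /\
    c * #|box B|%:R <= #|[set s in box B | [ffun i => cell (s i)] \in G]%SET|%:R.
Proof.
have half : (0 : R) < 2^-1 by rewrite invr_gt0.
have [c0 c0_gt0 hc0] := edet2_lower_bound D half.
pose F : R := D`!%:R; have F0 : 0 < F by rewrite ltr0n fact_gt0.
(* Determinants are at most [F] in modulus, and transversals outside the good cells add at most
   [c0 / 2] to a mean of at least [c0]. *)
exists (c0 / 2 / F ^+ 2); first by rewrite !divr_gt0 // exprn_gt0.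
pose c := Num.sqrt (c0 / 2); have c_gt0 : 0 < c by rewrite sqrtr_gt0 divr_gt0.
pose L : R := F * (D * D)%:R * (D * D)%:R.
have L0 : 0 <= L by rewrite !mulr_ge0 ?ler0n.
have [n n0 hn] : exists2 n : nat, 0 < n%:R :> R & L * n%:R^-1 <= c / 4.
  exists (Num.truncn (4 * L / c)).+1; first by rewrite ltr0n.
  have /andP[_] := truncn_itv (divr_ge0 (mulr_ge0 (ler0n R 4) L0) (ltW c_gt0)).
  rewrite ltr_pdivrMr // ler_pdivrMr ?ltr0n // => h; lra.
exists {ffun 'I_D -> 'I_(2 * n).+1} => T v B B0 vB.
have [|g ug hg] := @forster R D T v B B0.
  by move=> s hs; apply: vB; rewrite inE; apply/forallP.
pose u a := unitize (v a *m g).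
have u1 a : sqnorm (u a) <= 1 by exact: sqnorm_unitize_le1.
pose M (s : {ffun 'I_D -> T}) : 'M[R]_D := \matrix_i u (s i).
have ME s i j : M s i j = u (s i) 0 j by rewrite [LHS]mxE.
have M1 s i j : `|M s i j| <= 1 by rewrite ME entry_le1.
(* Coordinates in [[-1, 1]] are moved to [[0, 2n]] and rounded down; the value [2n] occurs for the
   coordinate 1, whence [2n + 1] cells per axis. *)
pose cell a : {ffun 'I_D -> 'I_(2 * n).+1} :=
  [ffun j => inord (Num.truncn ((u a 0 j + 1) * n%:R))].
have hcell a b : cell a = cell b -> forall j, `|u a 0 j - u b 0 j| <= n%:R^-1.
  move=> /ffunP eq j; have := congr1 val (eq j); rewrite !ffunE /=.
  have rg x : 0 <= (u x 0 j + 1) * n%:R /\ (Num.truncn (((u x 0 j + 1) * n%:R)%R) < (2 *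
    n).+1)%N.
    have := entry_le1 j (u1 x); rewrite ler_norml => /andP[l1 l2].
    have p : 0 <= (u x 0 j + 1) * n%:R by rewrite mulr_ge0 // ?ler0n //; lra.
    split => //; rewrite ltnS -(ler_nat R); apply: (@le_trans _ _ ((u x 0 j + 1) * n%:R));
      first by rewrite truncn_le.
    by rewrite natrM ler_wpM2r ?ler0n //; lra.
  have [pa ta] := rg a; have [pb tb] := rg b; rewrite !inordK // => e.
  have /andP[a1 a2] := truncn_itv pa.
  have /andP[b1 b2] := truncn_itv pb.
  rewrite -e in b1 b2; move: a1 a2 b1 b2; move: (Num.truncn _) => q;
    rewrite -natr1 => a1 a2 b1 b2.
  rewrite -(ler_pM2r n0) mulVf ?gt_eqF // -[n%:R in leLHS]gtr0_norm // -normrM.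
  rewrite ler_norml; apply/andP; split; lra.
pose P (s : {ffun 'I_D -> T}) := (s \in box B) && (c0 / 2 <= \det (M s) ^+ 2).
pose cells (s : {ffun 'I_D -> T}) := [ffun i => cell (s i)].
pose G := [set y | [exists s, P s && (cells s == y)]]%SET.
(* The common point is the row sum of a representative with large determinant, carried back by
   [invmx g]; the default 0 arises only for [y] outside [G]. *)
pose X y := if [pick s | P s && (cells s == y)] is Some s
            then (\sum_i u (s i)) *m invmx g else 0.
exists cell, X, G; split.
  move=> s sB; rewrite inE => /existsP [s0 hs0]; rewrite /X; case: pickP => [r|/(_ s0)];
    last first.
    by rewrite hs0.
  move=> {s0 hs0} /andP[/andP[rB rdet] /eqP er].
  apply: in_cone_unitize => // [i|].
    apply: (@transversal_neq0 R D T v B B0 _ i) => //.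
      by move=> t ht; apply: vB; rewrite inE; apply/forallP.
    by move: sB; rewrite inE => /forallP.
  have hMN i j : `|M r i j - M s i j| <= n%:R^-1.
    by rewrite !ME; apply: hcell; have := congr1 (fun f : {ffun _ -> _} => f i) er;
      rewrite !ffunE.
  have hdet : c <= `|\det (M r)| by rewrite -sqrtr_sqr ler_wsqrtr.
  have hsm : D`!%:R * (D * D)%:R * n%:R^-1 * (D * D)%:R <= c / 4.
    by apply: le_trans hn; rewrite /L /F mulrAC.
  have [w w0 hw] := close_in_cone (M1 r) (M1 s) hMN c_gt0 hdet hsm.
  exists w => //; under [LHS]eq_bigr do rewrite -(rowK (fun i => u (r i))).
  rewrite hw; apply: eq_bigr => i _; by rewrite rowK.
have hE : c0 <= edet2 (uniform R B) (fun=> u).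
  apply: hc0 => //.
  - by move=> i a; rewrite /uniform divr_ge0 ?ler0n.
  - move=> i; rewrite -(mean_cst 1 (B0 i)) -sum_uniform.
    by apply: eq_bigr => a _; rewrite mulr1.
  - exact: spread_unitize.
set A := [set s in box B | _]%SET.
have box0 : 0 < #|box B|%:R :> R.
  by rewrite ltr0n card_box prodn_gt0 // => i; rewrite card_gt0.
rewrite edet2_uniform ler_pdivlMr // in hE.
have hup : \sum_(s in box B) \det (\matrix_i u (s i)) ^+ 2 <=
    F ^+ 2 * #|A|%:R + c0 / 2 * #|box B|%:R.
  rewrite (bigID (mem A)) /=; apply: lerD.
    apply: (@le_trans _ _ (\sum_(s in A) F ^+ 2)).
      rewrite [leLHS](eq_bigl (fun s => s \in A)); last first.
        move=> s; apply/andP/idP => [[]//|sA]; split=> //.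
        by move: sA; rewrite inE => /andP[].
      apply: ler_sum => s _; rewrite -[leLHS]real_normK ?num_real //.
      by rewrite lerXn2r ?nnegrE ?ler0n // (det_le_fact (M1 s)).
    by rewrite sumr_const mulr_natr.
  apply: (@le_trans _ _ (\sum_(s in box B) c0 / 2)); last first.
    by rewrite sumr_const mulr_natr.
  rewrite [leRHS](bigID (mem A)) /= ler_wpDl ?sumr_ge0 //.
    by move=> s _; rewrite divr_ge0 // ltW.
  apply: ler_sum => s /andP[sB sA]; rewrite leNgt; apply: contra sA => hlt.
  rewrite inE sB /= inE; apply/existsP; exists s.
  by rewrite /P sB eqxx (ltW hlt).
rewrite mulrAC ler_pdivrMr ?exprn_gt0 // mulrC.
by move: (le_trans hE hup); set y := _%:R; set z := F ^+ 2; set x := _%:R; nra.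
Qed.

(** * Density increment on boxes *)

Definition heavy_point (R : numDomainType) (D : nat) (T : finType) (v : T -> 'rV[R]_D)
    (omega : {ffun 'I_D -> T} -> R) (m : R) : Prop :=
  exists x (A : {set {ffun 'I_D -> T}}),
    (forall s, s \in A -> in_cone v s x) /\ m <= \sum_(s in A) omega s.

(* Density increment: either a good cell tuple has positive weight, or [omega] lives on the
   bad cell tuples, which cover at most a proportion [1 - c] of the box, so that on a
   large sub-box its density is larger by a constant factor.  The density is at
   most 1, so the second case occurs a bounded number of times. *)
Lemma box_selection (R : realType) (D : nat) (delta : R) : 0 < delta ->
  exists2 beta : R, 0 < beta & forall (T : finType) (v : T -> 'rV[R]_D)
    (B : 'I_D -> {set T}) (omega : {ffun 'I_D -> T} -> R),
    (forall s, s \in box B -> \det (\matrix_i v (s i)) != 0) ->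
    (forall s, 0 <= omega s <= 1) -> (0 < #|box B|)%N ->
    delta * #|box B|%:R <= \sum_(s in box B) omega s ->
  heavy_point v omega (beta * #|box B|%:R).
Proof.
have [c1 c1_gt0 [K hK]] := good_cells R D.
pose c := Num.min c1 1; have c0 : 0 < c by rewrite lt_min c1_gt0 ltr01.
have cc1 : c <= c1 by rewrite ge_min lexx.
have c_le1 : c <= 1 by rewrite ge_min lexx orbT.
(* The density grows by a factor [1 / q] per increment; the choice ensures [1 - c <= q ^+ 2]. *)
pose q := 1 - c / 2.
have q0 : 0 < q by rewrite /q; lra.
have q1 : q < 1 by rewrite /q; lra.
(* With thresholds of the form [q ^+ N], one increment lowers [N] by one, so the proof is an
   induction on [N]. *)
suff step N : exists2 beta : R, 0 < beta & forall (T : finType) (v : T -> 'rV[R]_D)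
    (B : 'I_D -> {set T}) (omega : {ffun 'I_D -> T} -> R),
    (forall s, s \in box B -> \det (\matrix_i v (s i)) != 0) ->
    (forall s, 0 <= omega s <= 1) -> (0 < #|box B|)%N ->
    q ^+ N * #|box B|%:R <= \sum_(s in box B) omega s ->
  heavy_point v omega (beta * #|box B|%:R).
  move=> delta0.
  have [N hN] : exists N, q ^+ N <= delta.
    pose N := (Num.truncn ((delta * (1 - q))^-1)).+1; exists N.
    have pos : 0 < delta * (1 - q) by rewrite mulr_gt0 // subr_gt0.
    have hN : (delta * (1 - q))^-1 < N%:R.
      by have /andP[] := truncn_itv (ltW (@etrans _ _ _ _ (invr_gt0 _) pos)).
    (* A Bernoulli-type estimate that makes the decay of [q ^+ n] explicit. *)
    have bern n : n%:R * (1 - q) * q ^+ n <= 1.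
      elim: n => [|n IH]; first by rewrite !mul0r.
      have qn : q ^+ n.+1 <= 1 by rewrite exprn_ile1 // ltW.
      have qn0 : 0 <= q ^+ n by rewrite exprn_ge0 // ltW.
      have qn1 : q ^+ n <= 1 by rewrite exprn_ile1 // ltW.
      rewrite -natr1 exprS; move: IH qn qn0 qn1; rewrite exprS.
      move: (q ^+ n) (n%:R) => y z; nra.
    have := bern N; move: hN; rewrite -[X in X < _]mulr1 ltr_pdivrMl //.
    have qN0 : 0 < q ^+ N by rewrite exprn_gt0.
    move: (q ^+ N) (N%:R) qN0 => y z *; nra.
  have [beta beta0 h] := step N; exists beta => // T v B omega h1 h2 h3 h4.
  by apply: h => //; apply: le_trans h4; rewrite ler_wpM2r.
pose m : R := #|{: {ffun 'I_D -> K}}|.+1%:R; have m0 : 0 < m by rewrite ltr0n.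
(* The fraction [k] is so small that pieces of weight at most [k * #|box B|], one for each tuple of
   cells, total at most [c * d / 8 * #|box B|]. *)
have dichotomy n (d := q ^+ n) (k := c * d / (8 * m)) (T : finType) (v : T -> 'rV[R]_D)
    (B : 'I_D -> {set T}) (omega : {ffun 'I_D -> T} -> R) :
    (forall s, s \in box B -> \det (\matrix_i v (s i)) != 0) ->
    (forall s, 0 <= omega s <= 1) -> (0 < #|box B|)%N ->
    d * #|box B|%:R <= \sum_(s in box B) omega s ->
  heavy_point v omega (k * #|box B|%:R) \/ exists C : 'I_D -> {set T}, [/\ box C \subset box B,
    k * #|box B|%:R <= #|box C|%:R & d * #|box C|%:R <= q * \sum_(s in box C) omega s].
  move=> hv ho hB hd.
  have B0 i : B i != finset.set0.
    by move: hB; rewrite card_box (bigD1 i) //= muln_gt0 card_gt0 => /andP[].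
  have [cell [X [G [hX hG]]]] := hK T v B B0 hv.
  pose C (y : {ffun 'I_D -> K}) i := [set a in B i | cell a == y i]%SET.
  pose cells (s : {ffun 'I_D -> T}) : {ffun 'I_D -> K} := [ffun i => cell (s i)].
  have inC y s : (s \in box (C y)) = (s \in box B) && (cells s == y).
    rewrite !inE; apply/forallP/andP => [h|[/forallP h /eqP <-] i].
      split; first by apply/forallP => i; have := h i; rewrite inE => /andP[].
      apply/eqP/ffunP => i; rewrite ffunE.
      by have := h i; rewrite inE => /andP[_ /eqP].
    by rewrite inE h /cells ffunE /=.
  have sumC (f : {ffun 'I_D -> T} -> R) :
      \sum_(s in box B) f s = \sum_y \sum_(s in box (C y)) f s.
    rewrite (partition_big cells xpredT) //=; apply: eq_bigr => y _.
    by apply: eq_bigl => s; rewrite inC.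
  pose S y := \sum_(s in box (C y)) omega s.
  have SN y : S y <= #|box (C y)|%:R.
    by rewrite -sum1_card natr_sum; apply: ler_sum => s _; case/andP: (ho s).
  have [[y [yG hy]]|hno1] := EM (exists y, y \in G /\ k * #|box B|%:R <= S y).
    left; exists (X y), (box (C y)); split=> // s; rewrite inC => /andP[sB /eqP sy].
    by rewrite -sy; apply: hX => //; rewrite -/(cells s) sy.
  have [[y [y1 y2]]|hno2] := EM (exists y, k * #|box B|%:R <= #|box (C y)|%:R /\
      d * #|box (C y)|%:R <= q * S y).
    right; exists (C y); split=> //.
    by apply/fintype.subsetP => s; rewrite inC => /andP[].
  exfalso; move: hd; apply/negP; rewrite -ltNge sumC.
  have d0 : 0 < d by rewrite exprn_gt0.
  have k0 : 0 < k by rewrite divr_gt0 ?mulr_gt0.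
  have bB : 0 < #|box B|%:R :> R by rewrite ltr0n.
  (* When both alternatives fail, good tuples of cells are light, and a bad one either has a small
     box, hence small weight because [omega <= 1], or has density below [d / q]. *)
  have hS y : S y <= k * #|box B|%:R + d / q * ((y \notin G)%:R * #|box (C y)|%:R).
    case: (boolP (y \in G)) => yG /=.
      rewrite mul0r mulr0 addr0 leNgt; apply/negP => h; apply: hno1.
      by exists y; rewrite yG ltW.
    rewrite mul1r; case: (leP (k * #|box B|%:R) #|box (C y)|%:R) => hk.
      apply: ler_wpDl; first by rewrite mulr_ge0 ?ler0n // ltW.
      rewrite mulrAC ler_pdivlMr // [leLHS]mulrC leNgt; apply/negP => h; apply: hno2.
      by exists y; rewrite hk ltW.
    apply: ler_wpDr; first by rewrite mulr_ge0 ?ler0n // divr_ge0 // ltW.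
    apply: ltW; exact: le_lt_trans (SN y) hk.
  apply: (@le_lt_trans _ _ (\sum_y (k * #|box B|%:R + d / q * ((y \notin G)%:R * #|box (C
    y)|%:R)))).
    by apply: ler_sum => y _; exact: hS.
  rewrite big_split /= sumr_const -mulr_sumr.
  have -> : \sum_y ((y \notin G)%:R * #|box (C y)|%:R) =
      #|box B|%:R - #|[set s in box B | cells s \in G]%SET|%:R :> R.
    apply/eqP; rewrite eq_sym subr_eq; apply/eqP.
    rewrite -!sum1_card !natr_sum sumC.
    rewrite [X in _ = _ + X](_ : _ = \sum_(s in box B) (cells s \in G)%:R); last first.
      rewrite big_mkcond [RHS]big_mkcond; apply: eq_bigr => s _; rewrite inE.
      by case: (s \in box B); case: (cells s \in G).
    rewrite sumC -big_split; apply: eq_bigr => y _ /=.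
    rewrite -sum1_card natr_sum mulr_sumr -big_split /=.
    apply: eq_bigr => s; rewrite inC => /andP[_ /eqP ->].
    by case: (y \in G); rewrite ?mul1r ?mul0r ?add0r ?addr0.
  set g := #|[set s in box B | _]%SET|%:R; set b := #|box B|%:R.
  have hg : c * b <= g by apply: le_trans hG; rewrite ler_wpM2r ?ler0n.
  have hk : k * b *+ #|{: {ffun 'I_D -> K}}| <= c * d / 8 * b.
    rewrite -[leLHS]mulr_natr mulrAC ler_wpM2r ?ler0n //.
    apply: (@le_trans _ _ (k * m)); first by apply: ler_wpM2l; [exact: ltW|rewrite /m ler_nat].
    by rewrite /k invfM mulrA divfK // gt_eqF.
  (* The bad tuples of cells cover at most [(1 - c) * b]. Their weight [d * q * b] plus the light
     part [c * d / 8 * b] stays below [d * b], contradicting the assumed density. *)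
  have hq : d / q * (b - g) <= d * q * b.
    rewrite mulrAC ler_pdivrMr // -!mulrA ler_pM2l //.
    have : (1 - c) * b <= q * q * b by rewrite ler_pM2r // /q; nra.
    nra.
  apply: le_lt_trans (lerD hk hq) _.
  have db : 0 < d * b * c by rewrite !mulr_gt0.
  rewrite /q; nra.
elim: N => [|N [b b0 IH]].
  exists (c * q ^+ 0 / (8 * m)); first by rewrite divr_gt0 ?mulr_gt0 ?exprn_gt0.
  move=> T v B omega hv ho hB hd.
  have [//|[C [_ hk hC]]] := dichotomy 0 T v B omega hv ho hB hd.
  (* At threshold 1 an increment would produce a density above 1. *)
  exfalso; have bC : 0 < #|box C|%:R :> R.
    by apply: lt_le_trans hk; rewrite !mulr_gt0 ?exprn_gt0 ?invr_gt0 ?mulr_gt0 ?ltr0n.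
  have : \sum_(s in box C) omega s <= #|box C|%:R.
    by rewrite -sum1_card natr_sum; apply: ler_sum => s _; case/andP: (ho s).
  move: hC; rewrite expr0 mul1r; nra.
pose k := c * q ^+ N.+1 / (8 * m).
have k0 : 0 < k by rewrite divr_gt0 ?mulr_gt0 ?exprn_gt0.
(* After an increment, the sub-box still has a proportion [k] of the box, and the induction
   hypothesis gives a proportion [b] of that. *)
exists (Num.min k (b * k)); first by rewrite lt_min k0 mulr_gt0.
move=> T v B omega hv ho hB hd.
have [[x [A [hA hs]]]|[C [hCB hk hC]]] := dichotomy N.+1 T v B omega hv ho hB hd.
  exists x, A; split=> //; apply: (@le_trans _ _ (k * #|box B|%:R)); last exact: hs.
  rewrite ler_wpM2r ?ler0n //.
  by rewrite ge_min lexx.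
have bC : 0 < #|box C|%:R :> R by apply: lt_le_trans hk; rewrite mulr_gt0 ?ltr0n.
have [||||x [A [hA hs]]] := IH T v C omega.
- by move=> s sC; apply: hv; apply: (fintype.subsetP hCB).
- exact: ho.
- by rewrite -(ltr0n R).
- by move: hC; rewrite exprS -mulrA ler_pM2l.
exists x, A; split=> //; apply: le_trans hs.
apply: (@le_trans _ _ (b * (k * #|box B|%:R))); last by rewrite ler_pM2l.
by rewrite [leRHS]mulrA ler_wpM2r ?ler0n // ge_min lexx orbT.
Qed.

(** * Selecting a point in many simplices *)

(** The values at the [D] distinct points [t i] are forced and the others are free. It counts both
    the colorings that make a tuple transversal and the extensions of a [(d+1)]-tuple to a
    [k]-tuple. *)
Lemma card_ffun_prescribed (D : nat) (I J : finType) (t : 'I_D -> I) (c : 'I_D -> J) :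
  injective t ->
  #|[set f : {ffun I -> J} | [forall i, f (t i) == c i]]%SET| = (#|J| ^ (#|I| - D))%N.
Proof.
move=> t_inj; pose B x : {set J} := [set b | [forall i, (t i == x) ==> (c i == b)]]%SET.
have -> : [set f : {ffun I -> J} | [forall i, f (t i) == c i]]%SET = box B.
  apply/setP => f; rewrite !inE; apply/forallP/forallP => h x.
    by rewrite inE; apply/forallP => i; apply/implyP => /eqP <-; rewrite eq_sym.
  by have := h (t x); rewrite inE => /forallP /(_ x); rewrite eqxx eq_sym.
have cT : #|[set t i | i : 'I_D]%SET| = D by rewrite card_imset ?card_ord.
rewrite card_box (bigID (mem [set t i | i : 'I_D]%SET)) /= big1 => [|x /imsetP[i _ ->]].
  rewrite mul1n (eq_bigr (fun=> #|J|)) => [|x hx].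
    rewrite prod_nat_const; congr (_ ^ _)%N;
      rewrite -[D in RHS]cT -[X in (X - _)%N](cardsC [set t i | i : 'I_D]%SET) addKn.
    by apply: eq_card => x; rewrite !inE.
  apply: eq_card => b; rewrite !inE; apply/forallP => i; apply/implyP => /eqP e.
  by move: hx; rewrite -e imset_f.
apply/eqP/cards1P; exists (c i); apply/setP => b; rewrite !inE.
apply/forallP/eqP => [/(_ i)|-> j]; first by rewrite eqxx => /eqP.
by apply/implyP => /eqP /t_inj ->.
Qed.

(* On average over all [f : 'I_n -> 'I_D], the transversals of the partition into the
   fibres of [f] carry a proportion [D ^- D] of the weight. *)
Lemma point_selection (R : realType) (D : nat) (delta : R) : (0 < D)%N -> 0 < delta ->
  exists2 beta : R, 0 < beta & forall (n : nat) (v : 'I_n -> 'rV[R]_D)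
    (omega : {ffun 'I_D -> 'I_n} -> R), (0 < n)%N ->
    (forall s : {ffun 'I_D -> 'I_n}, injective s -> \det (\matrix_i v (s i)) != 0) ->
    (forall s, 0 <= omega s <= 1) ->
    (forall s : {ffun 'I_D -> 'I_n}, omega s != 0 -> injective s) ->
    delta * n%:R ^+ D <= \sum_s omega s ->
  heavy_point v omega (beta * n%:R ^+ D).
Proof.
move=> D0 delta0; pose e : R := delta / D%:R ^+ D.
have DD : 0 < D%:R ^+ D :> R by rewrite exprn_gt0 // ltr0n.
have e0 : 0 < e by rewrite divr_gt0.
have [b b0 hb] := box_selection D e0.
(* As weights are at most 1, the best box has at least [e * n%:R ^+ D] elements, and a proportion
   [b] of it is kept. *)
exists (b * e); first by rewrite mulr_gt0.
move=> n v omega n0 hv ho hinj hd.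
have nD : 0 < n%:R ^+ D :> R by rewrite exprn_gt0 // ltr0n.
pose B (f : {ffun 'I_n -> 'I_D}) i := [set a | f a == i]%SET.
pose W f := \sum_(s in box (B f)) omega s.
have Dn : (D <= n)%N.
  rewrite leqNgt; apply/negP => nltD.
  have : \sum_s omega s = 0.
    apply: big1 => s _; apply/eqP; apply: contraTT nltD => /hinj /leq_card.
    by rewrite !card_ord -leqNgt.
  move: hd => /[swap] ->; apply/negP; rewrite -ltNge mulr_gt0 //.
have hsum : \sum_f W f = (D ^ (n - D))%:R * \sum_s omega s.
  rewrite /W; under eq_bigr do rewrite big_mkcond.
  rewrite exchange_big /= mulr_sumr; apply: eq_bigr => s _.
  rewrite -big_mkcond /= sumr_const -[LHS]mulr_natl.
  have [->|/hinj s_inj] := eqVneq (omega s) 0; first by rewrite !mulr0.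
  congr (_%:R * _); rewrite -[X in (X ^ _)%N](card_ord D) -[X in (_ ^ (X - _))%N](card_ord n).
  rewrite -(card_ffun_prescribed (fun i => i) s_inj); apply: eq_card => f.
  rewrite [RHS]inE [LHS](_ : _ = (s \in box (B f))) // inE.
  by apply: eq_forallb => i; rewrite inE.
pose f0 : {ffun 'I_n -> 'I_D} := [ffun=> Ordinal D0].
pose f := [arg max_(g > f0) W g]%O.
have hf g : W g <= W f by rewrite /f; case: arg_maxP => // i _; apply.
have hW : e * n%:R ^+ D <= W f.
  have h : (D ^ (n - D))%:R * \sum_s omega s <= (D ^ n)%:R * W f.
    rewrite -hsum mulr_natl.
    have -> : (D ^ n)%N = #|{: {ffun 'I_n -> 'I_D}}| by rewrite card_ffun !card_ord.
    by rewrite -sumr_const; apply: ler_sum.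
  have p : 0 < (D ^ (n - D))%:R :> R by rewrite ltr0n expn_gt0 D0.
  have eD : (D ^ n = D ^ (n - D) * D ^ D)%N by rewrite -expnD subnK.
  move: h; rewrite eD natrM -mulrA ler_pM2l // natrX => h.
  by rewrite /e mulrAC ler_pdivrMr // [leRHS]mulrC; apply: le_trans hd _.
have Wbox : W f <= #|box (B f)|%:R.
  by rewrite -sum1_card natr_sum; apply: ler_sum => s _; case/andP: (ho s).
have box_n : #|box (B f)|%:R <= n%:R ^+ D :> R.
  rewrite -natrX ler_nat; apply: leq_trans (max_card _) _.
  by rewrite card_ffun !card_ord.
have sB s : s \in box (B f) -> injective s.
  rewrite inE => /forallP h i j eq.
  by have := h i; have := h j; rewrite !inE eq => /eqP -> /eqP.
have [||||x [A [hA hs]]] := hb _ v (B f) omega.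
- by move=> s /sB; exact: hv.
- exact: ho.
- by rewrite -(ltr0n R) (lt_le_trans _ Wbox) // (lt_le_trans _ hW) // mulr_gt0.
- by apply: le_trans hW; rewrite ler_pM2l.
exists x, A; split=> //; apply: le_trans hs.
by rewrite -mulrA ler_pM2l // (le_trans hW).
Qed.

(** * Points in general position *)

(** A nonzero kernel vector is an affine function vanishing at all [d + 1] points. Its linear part
    [z] is nonzero, since otherwise its constant term would vanish too, so its zero set is a
    hyperplane through these points. *)
Lemma general_position_det_neq0 (R : realType) (d n : nat) (P : 'I_n -> 'rV[R]_d)
    (s : 'I_d.+1 -> 'I_n) : (0 < d)%N -> general_position P -> injective s ->
  \det (orientation_mx (P \o s)) != 0.
Proof.
case: d P s => // d P s _ gp s_inj; apply/negP => det0.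
pose M := orientation_mx (P \o s).
have : M^T \notin unitmx by rewrite unitmxE det_tr unitfE det0.
rewrite -row_free_unit -kermx_eq0 => /rowV0Pn [c /sub_kermxP hc c0].
pose C : 'cV[R]_(1 + d.+1) := c^T.
have MC i : usubmx C + P (s i) *m dsubmx C = 0.
  have : M *m C = 0 by rewrite -[M]trmxK -trmx_mul hc trmx0.
  move=> /(congr1 (row i)); rewrite row_mul rowK row0 => <-.
  rewrite -[X in X + _](mul1mx (usubmx C)) -[in RHS](vsubmxK C); symmetry.
  exact: (@mul_row_col _ 1 1 d.+1 1).
set z := dsubmx C in MC.
have z0 : z != 0.
  apply: contra c0 => /eqP z0.
  have u0 : usubmx C = 0 by rewrite -(MC ord0) z0 mulmx0 addr0.
  by rewrite -[c]trmxK -/C -[C]vsubmxK u0 -/z z0 col_mx0 trmx0.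
pose f : 'Hom('rV[R]_d.+1, 'rV[R]_1) := linfun (mulmxr z).
have dimf : \dim (limg f) = 1%N.
  apply/eqP; rewrite eqn_leq; apply/andP; split.
    by apply: leq_trans (dimvS (subvf _)) _; rewrite dimvf.
  rewrite lt0n dimv_eq0; apply: contra z0 => /eqP im0.
  apply/eqP/matrixP => i j; rewrite ord1 mxE.
  have : f (delta_mx 0 i) \in limg f by rewrite memv_img // memvf.
  rewrite im0 memv0 lfunE /= -rowE => /eqP /matrixP /(_ 0 0); by rewrite !mxE.
have dimV : \dim (lker f) = d.
  have := limg_ker_dim f fullv; rewrite capfv dimf dimvf /dim /= mul1n addn1.
  by case.
pose J : {set 'I_n} := [set s i | i : 'I_d.+2]%SET.
have cJ : #|J| = d.+2 by rewrite card_imset ?card_ord.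
apply: (gp d J cJ (leqnn _) [set x | x - P (s ord0) \in lker f]%classic).
  by exists (P (s ord0)), (lker f).
move=> _ /imsetP[i _ ->] /=; rewrite memv_ker lfunE /= mulmxBl.
by rewrite -[_ *m z](addKr (usubmx C)) MC -[X in _ - X](addKr (usubmx C)) MC subrr.
Qed.

(** The barycentric coordinates [b y] depend continuously on [y]. At the rescaled point they are the
    weights [w] divided by their sum [x 0 0], hence positive, and they stay positive nearby. *)
Lemma interior_simplex (R : realType) (d : nat) (p : 'I_d.+1 ->
  'rV[R]_d) (x : 'rV[R]_(1 + d)) :
  \det (orientation_mx p) != 0 -> in_cone (fun i => row_mx 1%:M (p i)) id x ->
  interior (simplex p) ((x 0 0)^-1 *: rsubmx x).
Proof.
move=> detM [w w0 xE].
pose M : 'M[R]_(1 + d) := orientation_mx p.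
have uM : M \in unitmx by rewrite unitmxE unitfE.
pose b (y : 'rV[R]_d) : 'rV[R]_(1 + d) := row_mx 1%:M y *m invmx M.
have bM y : b y *m M = row_mx 1%:M y by rewrite mulmxKV.
have in_simplex y : (forall i, 0 < b y 0 i) -> simplex p y.
  move=> hy; exists (fun i => b y 0 i); split=> [i||]; first exact: ltW.
    have := congr1 (fun z : 'rV_(1 + d) => z 0 (lshift d 0)) (bM y).
    rewrite row_mxEl [RHS]mxE eqxx mulr1n => <-; rewrite mxE; apply: eq_bigr => i _.
    have -> : M i (lshift d 0) = 1 by rewrite [LHS]mxE row_mxEl mxE eqxx.
    by rewrite mulr1.
  have := congr1 (fun z : 'rV_(1 + d) => rsubmx z) (bM y); rewrite row_mxKr => eq;
    rewrite -[LHS]eq.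
  rewrite mulmx_sum_row linear_sum; apply: eq_bigr => i _.
  by rewrite linearZ /= rowK row_mxKr.
have x0 : x 0 0 = \sum_i w i.
  have e0 : 0 = lshift d 0 :> 'I_(1 + d) by apply/val_inj.
  by rewrite xE summxE; apply: eq_bigr => i _;
    rewrite mxE [X in row_mx _ _ _ X]e0 row_mxEl mxE eqxx mulr1.
have x0_gt0 : 0 < x 0 0.
  rewrite x0 (bigD1 ord0) //= ltr_wpDr // sumr_ge0 // => i _; exact: ltW.
set q := _ *: _.
have bq i : b q 0 i = (x 0 0)^-1 * w i.
  have -> : b q = (x 0 0)^-1 *: \row_i w i.
    rewrite /b; have -> : row_mx 1%:M q = (x 0 0)^-1 *: (\row_i w i *m M).
      have -> : \row_i w i *m M = x.
        rewrite xE mulmx_sum_row; apply: eq_bigr => j _.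
        by rewrite mxE rowK.
      rewrite -[X in _ = _ *: X]hsubmxK scale_row_mx; congr row_mx.
      apply/matrixP => a c; rewrite !ord1 !mxE eqxx; symmetry.
      have -> : lshift d 0 = 0 :> 'I_(1 + d) by apply/val_inj.
      by rewrite mulVf ?mulr1n // gt_eqF.
    by rewrite -scalemxAl mulmxK.
  by rewrite !mxE.
suff : nbhs q [set y : 'rV[R]_d | forall i, 0 < b y 0 i]%classic.
  by apply: filterS => y; exact: in_simplex.
apply: (@filter_forall _ _ (fun i => [set y : 'rV[R]_d | 0 < b y 0 i]%classic) (nbhs q)) => i.
have hc : continuous (fun y : 'rV[R]_d => b y 0 i).
  have -> : (fun y : 'rV[R]_d => b y 0 i) =
      (fun y => invmx M 0 i + \sum_j y 0 j * invmx M (rshift 1 j) i).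
    apply/funext => y; rewrite mxE (@big_split_ord _ _ _ 1 d) /= big_ord1.
    have e0 : lshift d 0 = 0 :> 'I_(1 + d) by apply/val_inj.
    rewrite row_mxEl mxE eqxx mul1r e0; congr (_ + _).
    by apply: eq_bigr => j _; rewrite row_mxEr.
  have hS : continuous (fun y : 'rV[R]_d => \sum_j y 0 j * invmx M (rshift 1 j) i).
    apply: continuous_big => [|j _ y]; first exact: add_continuous.
    by apply: continuousM; [exact: coord_continuous|exact: cst_continuous].
  by move=> y; apply: continuousD; [exact: cst_continuous|exact: hS].
apply: (@cvgr_gt R _ (nbhs q) _ (fun y => b y 0 i) (b q 0 i) (hc q)).
by rewrite bq mulr_gt0 // invr_gt0.
Qed.

Lemma increasing_inj (m k : nat) (t : {ffun 'I_m -> 'I_k}) :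
  t \in increasing m k -> injective t.
Proof.
rewrite inE => /forallP h i j eq; apply/val_inj/eqP.
have lt (a b : 'I_m) : (a < b)%N -> (t a < t b)%N by move/forallP: (h a) => /(_ b) /implyP.
by case: ltngtP => // /lt; rewrite eq ltnn.
Qed.

(** Each [(d+1)]-tuple is weighted by the number of members of [T] extending it along [t], divided
    by the number [N] of all its extensions. A heavy point for these weights pins every member of
    [T] that extends a chosen tuple. *)
Lemma pin_one (R : realType) (d k : nat) (t : {ffun 'I_d.+1 -> 'I_k}) (delta : R) :
  (0 < d)%N -> t \in increasing d.+1 k -> 0 < delta ->
  exists2 beta : R, 0 < beta & forall (n : nat) (P : 'I_n -> 'rV[R]_d)
    (T : {set {ffun 'I_k -> 'I_n}}), general_position P -> T \subset increasing k n ->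
    delta * n%:R ^+ k <= #|T|%:R ->
  exists (T' : {set {ffun 'I_k -> 'I_n}}) (q : 'rV[R]_d),
    [/\ T' \subset T, beta * n%:R ^+ k <= #|T'|%:R &
        forall s, s \in T' -> interior (simplex ((P \o s) \o t)) q].
Proof.
move=> d0 /increasing_inj t_inj delta0.
have Dk : (d.+1 <= k)%N by rewrite -[d.+1]card_ord -[k]card_ord; exact: leq_card t_inj.
have [b b0 hb] := point_selection (ltn0Sn d) delta0.
exists b => // n P T gp Tinc hT.
have [n0|n0] := posnP n.
  subst n; exists T, 0; split => //.
    by rewrite expr0n gtn_eqF ?mulr0 // (leq_trans _ Dk).
  move=> s; have := s (Ordinal (leq_trans (ltn0Sn d) Dk)).
  by case.
pose N : R := n%:R ^+ (k - d.+1).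
have N0 : 0 < N by rewrite exprn_gt0 // ltr0n.
have nk : n%:R ^+ k = N * n%:R ^+ d.+1 by rewrite -exprD subnK.
pose sub (s : {ffun 'I_k -> 'I_n}) : {ffun 'I_d.+1 -> 'I_n} := [ffun i => s (t i)].
pose omega r : R := #|[set s in T | sub s == r]%SET|%:R / N.
pose v a : 'rV[R]_(1 + d) := row_mx 1%:M (P a).
have vM (s : 'I_d.+1 -> 'I_n) : \matrix_i v (s i) = orientation_mx (P \o s).
  by apply/row_matrixP => i; rewrite !rowK.
have sumA (A : {set {ffun 'I_d.+1 -> 'I_n}}) :
    N * \sum_(r in A) omega r = #|[set s in T | sub s \in A]%SET|%:R.
  rewrite mulr_sumr -sum1_card natr_sum.
  rewrite (partition_big sub (mem A)) /=; last by move=> s; rewrite inE => /andP[].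
  apply: eq_bigr => r rA; rewrite mulrC divfK ?gt_eqF // -sum1_card natr_sum.
  apply: eq_bigl => s; rewrite !inE; case: eqP => [->|]; rewrite ?andbT ?andbF //.
  by rewrite rA andbT.
have [||||x [A [hA hs]]] := hb n v omega n0.
- by move=> s s_inj; rewrite vM; exact: general_position_det_neq0.
- move=> r; apply/andP; split; first by rewrite divr_ge0 // ltW.
  rewrite ler_pdivrMr // mul1r /N -natrX ler_nat.
  have := card_ffun_prescribed r t_inj; rewrite !card_ord => <-.
  apply/subset_leq_card/fintype.subsetP => s; rewrite !inE => /andP[_ /eqP <-].
  by apply/forallP => i; rewrite ffunE.
- move=> r; rewrite /omega mulf_eq0 negb_or pnatr_eq0 cards_eq0 => /andP[/set0Pn[s sA] _].
  move: sA; rewrite inE => /andP[sT /eqP <-] i j; rewrite !ffunE => eq.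
  by apply: t_inj; apply: (increasing_inj (fintype.subsetP Tinc _ sT)).
- rewrite -(ler_pM2l N0) mulrCA -nk; apply: le_trans hT _.
  rewrite [X in N * X](eq_bigl (fun r => r \in [set: {ffun 'I_d.+1 -> 'I_n}]%SET)); last first.
    by move=> r; rewrite finset.in_setT.
  rewrite sumA ler_nat subset_leq_card //; apply/fintype.subsetP => s sT.
  by rewrite !inE sT.
exists [set s in T | sub s \in A]%SET, ((x 0 0)^-1 *: rsubmx (x : 'rV[R]_(1 + d))); split.
- by apply/fintype.subsetP => s; rewrite inE => /andP[].
- by rewrite -sumA nk mulrCA ler_pM2l.
move=> s; rewrite inE => /andP[sT sA].
have s_inj := increasing_inj (fintype.subsetP Tinc _ sT).
have -> : (P \o s) \o t = P \o sub s by apply/funext => i; rewrite /= ffunE.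
apply: interior_simplex; last by have [w w0 wx] := hA _ sA; exists w.
apply: general_position_det_neq0 => // i j; rewrite !ffunE => eq.
by apply: t_inj; apply: s_inj.
Qed.

(** The proportion kept for the earlier tuples serves as density for the next one, and passing to a
    subfamily preserves the points already found. *)
Lemma pin_seq (R : realType) (d k : nat) (r : seq {ffun 'I_d.+1 -> 'I_k}) (delta : R) :
  (0 < d)%N -> {subset r <= increasing d.+1 k} -> 0 < delta ->
  exists2 beta : R, 0 < beta & forall (n : nat) (P : 'I_n -> 'rV[R]_d)
    (T : {set {ffun 'I_k -> 'I_n}}), general_position P -> T \subset increasing k n ->
    delta * n%:R ^+ k <= #|T|%:R ->
  exists (T' : {set {ffun 'I_k -> 'I_n}}) (q : {ffun 'I_d.+1 -> 'I_k} -> 'rV[R]_d),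
    [/\ T' \subset T, beta * n%:R ^+ k <= #|T'|%:R &
        forall s t, s \in T' -> t \in r -> interior (simplex ((P \o s) \o t)) (q t)].
Proof.
move=> d0 + delta0; elim: r => [|t r IH] rinc.
  by exists delta => // n P T gp Tinc hT; exists T, (fun=> 0); split.
have [|b b0 hb] := IH; first by move=> x xr; apply: rinc; rewrite inE xr orbT.
have [|c c0 hc] := pin_one d0 _ b0 (t := t); first by apply: rinc; rewrite mem_head.
exists c => // n P T gp Tinc hT.
have [T1 [q1 [T1T hT1 hq1]]] := hb n P T gp Tinc hT.
have [T2 [q2 [T2T hT2 hq2]]] := hc n P T1 gp (fintype.subset_trans T1T Tinc) hT1.
exists T2, (fun x => if x == t then q2 else q1 x); split=> //.
  exact: fintype.subset_trans T1T.
move=> s x sT2; rewrite inE; case: eqP => [-> _|_ /= xr]; first exact: hq2.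
by apply: hq1 => //; apply: (fintype.subsetP T2T).
Qed.

(** After multiplication by [k!] the two sides compare factor by factor:
    [n * (k - i) <= k * (n - i)]. *)
Lemma exp_le_bin (n k : nat) : (k <= n)%N -> (n ^ k <= k ^ k * 'C(n, k))%N.
Proof.
move=> kn; rewrite -(leq_pmul2r (fact_gt0 k)) -mulnA bin_ffact.
have e (a : nat) : (a ^ k = \prod_(i < k) a)%N by rewrite prod_nat_const card_ord.
rewrite -[in leqLHS](ffactnn k) !ffact_prod !e -!big_split /=.
by apply: leq_prod => i _; have := ltn_ord i; nia.
Qed.

Theorem theorem9 (R : realType) (d k : nat) (delta : R) :
  (1 <= d)%N -> (1 <= k)%N -> 0 < delta ->
  exists beta : R, 0 < beta /\
    forall (n : nat) (P : 'I_n -> 'rV[R]_d)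
           (I : {set {ffun 'I_d.+1 -> 'I_k}})
           (T : {set {ffun 'I_k -> 'I_n}}) (rho : 'I_k -> 'rV[R]_d),
      general_position P ->
      I \subset increasing d.+1 k ->
      T \subset increasing k n ->
      delta * 'C(n, k)%:R <= #|T|%:R ->
      (forall s, s \in T -> copies (P \o s) rho) ->
      exists (T' : {set {ffun 'I_k -> 'I_n}})
             (q : {ffun 'I_d.+1 -> 'I_k} -> 'rV[R]_d),
        [/\ T' \subset T,
            beta * 'C(n, k)%:R <= #|T'|%:R &
            forall s, s \in T' -> pins I q (P \o s)].
Proof.
move=> d0 k0 delta0.
have kk0 : 0 < k%:R ^+ k :> R by rewrite exprn_gt0 // ltr0n.
(* All increasing tuples are pinned, so that [b] is fixed before [I] is given. The factor
   [k%:R ^+ k] converts ['C(n, k)] into [n ^ k]. *)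
have [|b b0 hb] := @pin_seq R d k (enum (increasing d.+1 k)) _ d0 _ (divr_gt0 delta0 kk0).
  by move=> t; rewrite mem_enum.
exists b; split=> // n P I T rho gp Iinc Tinc hT _.
(* For [n < k] the binomial coefficient is 0 and [T] is empty. *)
have [nk|kn] := ltnP n k.
  exists T, (fun=> 0); split=> //; first by rewrite bin_small // mulr0.
  move=> s sT; have := leq_card _ (increasing_inj (fintype.subsetP Tinc _ sT)).
  by rewrite !card_ord leqNgt nk.
have [|T' [q [T'T hT' hq]]] := hb n P T gp Tinc.
  apply: le_trans hT; rewrite mulrAC ler_pdivrMr // -mulrA ler_pM2l //.
  by rewrite mulrC -!natrX -natrM ler_nat exp_le_bin.
exists T', q; split=> // [|s sT' t tI].
  apply: le_trans hT'; rewrite ler_pM2l // -natrX ler_nat.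
  apply: leq_trans (_ : n ^_ k <= _)%N; first by rewrite bin_ffactd leq_div.
  by rewrite ffact_prod -[X in (_ ^ X)%N]card_ord -prod_nat_const leq_prod // => i _;
    exact: leq_subr.
by apply: hq => //; rewrite mem_enum; exact: (fintype.subsetP Iinc).
Qed.
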